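(* Let $\mathfrak{g}$ be a simple complex Lie algebra with Cartan subalgebra $\mathfrak{t}$ and a fixed choice of positive roots, with half sum $\delta$. Then $\mathbf{P}_1=0$ and $$\mathbf{P}_2=\left(\frac{\tau(q_2^\vee)-q_2^\vee(\delta)}{\dim\mathfrak{g}}\right)q_2\,\mathbf{P}_0$$ in $\mathcal{A}=\mathrm{Sym}_{\mathbb{C}}(\mathfrak{t}^*\oplus\mathfrak{t})$.
   Context: For a dominant weight $\lambda$, $\phi_\lambda$ is the irreducible finite-dimensional representation of $\mathfrak{g}$ with highest weight $\lambda$, and $P_k(\phi_\lambda)=\sum_\mu m_{\phi_\lambda}(\mu)\mu^k\in\mathrm{Sym}^k_{\mathbb{C}}(\mathfrak{t}^* )$, where $m_{\phi_\lambda}(\mu)$ is the multiplicity of the weight $\mu$. The function $\lambda\mapsto P_k(\phi_\lambda)$ extends uniquely to a polynomial function $\mathfrak{t}^*\to\mathrm{Sym}^k_{\mathbb{C}}(\mathfrak{t}^* )$, denoted $\mathbf{P}_k$. It is viewed as an element of $\mathcal{A}$, the algebra of complex-valued polynomials on pairs $(\mu,\nu)\in\mathfrak{t}^*\times\mathfrak{t}$, equivalently of $\mathrm{Sym}_{\mathbb{C}}(\mathfrak{t}^* )$-valued polynomials on $\mathfrak{t}^*$; so $\mathbf{P}_k(\lambda,\nu)=\sum_\mu m_{\phi_\lambda}(\mu)\langle\mu,\nu\rangle^k$ for $\lambda$ dominant. $K$ is the Killing form restricted to $\mathfrak{t}$, $\sigma:\mathfrak{t}\to\mathfrak{t}^*$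 is the isomorphism with $\langle\sigma(\nu),\nu'\rangle=K(\nu,\nu')$, and $K^\vee$ is the form on $\mathfrak{t}^*$ with $K^\vee(\sigma(\nu),\sigma(\nu'))=K(\nu,\nu')$. Define $q_2\in\mathrm{Sym}^2(\mathfrak{t}^* )$ by $q_2(\nu)=K(\nu,\nu)$ for $\nu\in\mathfrak{t}$ and $q_2^\vee\in\mathrm{Sym}^2(\mathfrak{t})$ by $q_2^\vee(\mu)=K^\vee(\mu,\mu)$ for $\mu\in\mathfrak{t}^*$. The map $\tau:\mathcal{A}\to\mathcal{A}$ is translation by $\delta$: $\tau(f)(\mu,\nu)=f(\mu+\delta,\nu)$. *)

(* Defs.v *)
From HB Require Import structures.
From mathcomp Require Import all_boot all_order all_algebra.
From mathcomp Require Import boolp classical_sets functions cardinality fsbigop.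
From mathcomp Require Import finmap reals complex.

Set Implicit Arguments.
Unset Strict Implicit.
Unset Printing Implicit Defensive.

Import Order.TTheory GRing.Theory Num.Theory.
Local Open Scope ring_scope.
Local Open Scope classical_set_scope.

HB.mixin Record Vector_isLieAlgebra (F : fieldType) g of Vector F g := {
  bracket : g -> g -> g;
  bracket_linearl : forall y, linear (bracket ^~ y);
  bracket_linearr : forall x, linear (bracket x);
  bracketxx : forall x, bracket x x = 0;
  bracket_jacobi : forall x y z,
    bracket x (bracket y z) + bracket y (bracket z x)
      + bracket z (bracket x y) = 0
}.

#[short(type="lieAlgType")]
HB.structure Definition LieAlgebra (F : fieldType) :=
  {g of Vector F g & Vector_isLieAlgebra F g}.

Section LieAlgebras.
Context (F : fieldType) (g : lieAlgType F).
Implicit Types (U W I t : {vspace g}) (x y z : g).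

Definition lie_ideal I := forall x y, y \in I -> bracket x y \in I.

Definition simple_lie :=
  (exists x y, bracket x y != 0) /\
  (forall I, lie_ideal I -> I = 0%VS \/ I = fullv).

Definition lie_subalgebra U :=
  forall x y, x \in U -> y \in U -> bracket x y \in U.

Definition brv U W : {vspace g} :=
  <<[seq bracket u w | u <- vbasis U, w <- vbasis W]>>%VS.

Definition lower_central U n : {vspace g} := iter n (brv U) U.

Definition lie_nilpotent U := exists n, lower_central U n = 0%VS.

Definition cartan_subalgebra t :=
  [/\ lie_subalgebra t, lie_nilpotent t
    & forall x, (forall y, y \in t -> bracket x y \in t) -> x \in t].

Definition representation (V : vectType F) (rho : 'Hom(g, 'End(V))) :=
  forall x y v, rho (bracket x y) v = rho x (rho y v) - rho y (rho x v).

Definition irreducible_rep (V : vectType F) (rho : 'Hom(g, 'End(V))) :=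
  (fullv != 0%VS :> {vspace V}) /\
  (forall W : {vspace V}, (forall x, (rho x @: W <= W)%VS) ->
     W = 0%VS \/ W = fullv).

HB.instance Definition _ x :=
  GRing.isSemilinear.Build F g g *:%R (bracket x)
    (GRing.semilinear_linear (bracket_linearr x)).

Definition ad_lfun x : 'End(g) := linfun (bracket x).

Lemma ad_lfun_linear : linear ad_lfun.
Proof.
move=> a x y; apply/lfunP => z; rewrite add_lfunE scale_lfunE !lfunE /=.
exact: bracket_linearl.
Qed.

HB.instance Definition _ :=
  GRing.isSemilinear.Build F g 'End(g) *:%R ad_lfun
    (GRing.semilinear_linear ad_lfun_linear).

Definition ad : 'Hom(g, 'End(g)) := linfun ad_lfun.

Lemma adE x y : ad x y = bracket x y.
Proof. by rewrite /ad lfunE /= lfunE. Qed.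

Definition lftrace (V : vectType F) (f : 'End(V)) : F :=
  \tr (passmx.mxof (vbasis {:V}) (vbasis {:V}) f).

Definition killing x y : F := lftrace (ad x \o ad y)%VF.

Lemma killingP a x y z :
  (killing (a *: x + y) z = a * killing x z + killing y z) *
  (killing z (a *: x + y) = a * killing z x + killing z y).
Proof.
rewrite /killing /lftrace; split; rewrite linearP.
- have -> : ((a *: ad x + ad y) \o ad z
             = a *: (ad x \o ad z) + (ad y \o ad z))%VF.
    by rewrite comp_lfunDl comp_lfunZl.
  by rewrite passmx.mxof_linear mxtraceD mxtraceZ.
- have -> : (ad z \o (a *: ad x + ad y)
             = a *: (ad z \o ad x) + (ad z \o ad y))%VF.
    by rewrite comp_lfunDr comp_lfunZr.
  by rewrite passmx.mxof_linear mxtraceD mxtraceZ.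
Qed.

Definition dual t := 'Hom(subvs_of t, F^o).

(* It suffices to impose [rho h v = mu h *: v] for h in a basis of t; see
   [weight_spaceP]. *)
Definition weight_space t (V : vectType F) (rho : 'Hom(g, 'End(V)))
    (mu : dual t) : {vspace V} :=
  (\bigcap_(h <- vbasis {:subvs_of t})
     passmx.leigenspace (rho (vsval h)) (mu h))%VS.

Lemma weight_spaceP t (V : vectType F) (rho : 'Hom(g, 'End(V))) (mu : dual t)
    (v : V) :
  reflect (forall h : subvs_of t, rho (vsval h) v = (mu h : F) *: v)
    (v \in weight_space rho mu).
Proof.
apply: (iffP idP) => [vP h|vP]; last first.
  rewrite /weight_space; elim/big_rec: _ => [|h W _ vW]; first exact: memvf.
  rewrite memv_cap vW andbT /passmx.leigenspace memv_ker.
  by rewrite add_lfunE opp_lfunE scale_lfunE id_lfunE vP subrr.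
have vb b : b \in vbasis {:subvs_of t} -> rho (vsval b) v = (mu b : F) *: v.
  move=> bb; move: vP; rewrite /weight_space (big_rem b) //= memv_cap.
  move=> /andP[]; rewrite /passmx.leigenspace memv_ker => vb _; move: vb.
  by rewrite add_lfunE opp_lfunE scale_lfunE id_lfunE subr_eq0 => /eqP.
rewrite (coord_vbasis (memvf h)) !linear_sum /= sum_lfunE scaler_suml.
apply: eq_bigr => i _; rewrite !linearZ /= scale_lfunE vb ?scalerA //.
by apply: mem_nth; rewrite size_tuple.
Qed.

Definition weight_mult t (V : vectType F) (rho : 'Hom(g, 'End(V)))
    (mu : dual t) : nat := \dim (weight_space rho mu).

Definition weights t (V : vectType F) (rho : 'Hom(g, 'End(V))) :
    set (dual t) := [set mu | weight_space rho mu != 0%VS].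

Lemma finite_leigenvalues (V : vectType F) (f : 'End(V)) :
  finite_set [set a | passmx.leigenspace f a != 0%VS].
Proof.
set e := vbasis {:V}; have eb : basis_of {:V} e by exact: vbasisP.
pose A := passmx.mxof e e f.
have sub : [set a | passmx.leigenspace f a != 0%VS]
    `<=` [set a | root (char_poly A) a].
  move=> a /=; rewrite (passmx.leigenspaceE eb) (passmx.vsof_eq0 eb) => ea.
  by rewrite -eigenvalue_root_char.
apply: (sub_finite_set sub).
apply: contrapT => /(infinite_set_fset (size (char_poly A))) [B BA].
apply/negP; rewrite -ltnNge; apply: max_poly_roots.
- exact/monic_neq0/char_poly_monic.
- by apply/allP => a /BA.
- exact: fset_uniq.
Qed.

Lemma finite_weights t (V : vectType F) (rho : 'Hom(g, 'End(V))) :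
  finite_set (@weights t V rho).
Proof.
set n : nat := \dim {:subvs_of t}; set e := vbasis {:subvs_of t}.
pose S := \bigcup_(i in [set: 'I_n])
  [set a | passmx.leigenspace (rho (vsval e`_i)) a != 0%VS].
have /finite_fsetP[B SB] : finite_set S.
  by apply: bigcup_finite => // i _; exact: finite_leigenvalues.
pose G (c : {ffun 'I_n -> B}) : dual t :=
  linfun (fun x : subvs_of t => (\sum_i coord e i x * val (c i)) : F^o).
apply: (@sub_finite_set _ _ (range G)); last exact: finite_image.
move=> mu /= wmu.
have muB (i : 'I_n) : (mu e`_i : F) \in B.
  suff: S (mu e`_i) by rewrite SB.
  exists i => //=; apply: contraNneq wmu => e0.
  rewrite -subv0 -e0 /weight_space (big_rem e`_i) ?capvSl //=.
  by apply: mem_nth; rewrite size_tuple.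
exists [ffun i => [` muB i]%fset] => //.
apply/lfunP => x; rewrite /G.
have lin : linear (fun x : subvs_of t =>
    (\sum_(i < n) coord e i x * val ([ffun i => [` muB i]%fset] i)) : F^o).
  move=> a u v; rewrite scaler_sumr -big_split /=; apply: eq_bigr => i _.
  by rewrite linearP mulrDl -mulrA.
pose L := GRing.isSemilinear.Build F _ _ *:%R _ (GRing.semilinear_linear lin).
pose Lf : {linear subvs_of t -> F^o} := HB.pack (fun x : subvs_of t =>
    (\sum_(i < n) coord e i x * val ([ffun i => [` muB i]%fset] i)) : F^o) L.
rewrite (lfunE Lf) /= [in RHS](coord_vbasis (memvf x)) linear_sum /=.
by apply: eq_bigr => i _; rewrite linearZ ffunE.
Qed.

Definition roots t : set (dual t) :=
  [set alpha | alpha != 0 /\ weights ad alpha].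

(* \sum_(mu \in _) is zero on sets where the summand has infinite support;
   the set of weights is always finite, see [finite_weights]. *)
Definition power_sum t (k : nat) (V : vectType F) (rho : 'Hom(g, 'End(V)))
    (nu : subvs_of t) : F :=
  \sum_(mu \in weights rho) (weight_mult rho mu)%:R * (mu nu : F) ^+ k.

Definition killing_iso t : 'Hom(subvs_of t, dual t) :=
  linfun (fun nu => linfun (fun nu' => killing (vsval nu) (vsval nu') : F^o)).

Lemma killing_isoE t (nu nu' : subvs_of t) :
  killing_iso t nu nu' = killing (vsval nu) (vsval nu').
Proof.
have lin2 (n : subvs_of t) : linear
    (fun nu' : subvs_of t => killing (vsval n) (vsval nu') : F^o).
  move=> a x y.
  have -> : vsval (a *: x + y) = a *: vsval x + vsval y.
    exact: (linearP vsval).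
  by rewrite [LHS](killingP _ _ _ _).2.
pose L2 n := GRing.isSemilinear.Build F _ _ *:%R _
  (GRing.semilinear_linear (lin2 n)).
pose f n : {linear subvs_of t -> F^o} := HB.pack
    (fun nu' : subvs_of t => killing (vsval n) (vsval nu') : F^o) (L2 n).
have lin1 : linear (fun n : subvs_of t => linfun (f n) : dual t).
  move=> a x y; apply/lfunP => z; rewrite add_lfunE scale_lfunE !lfunE.
  change (killing (vsval (a *: x + y)) (vsval z)
            = a * killing (vsval x) (vsval z) + killing (vsval y) (vsval z)).
  have -> : vsval (a *: x + y) = a *: vsval x + vsval y.
    exact: (linearP vsval).
  by rewrite killingP.
pose L1 := GRing.isSemilinear.Build F _ _ *:%R _
  (GRing.semilinear_linear lin1).
pose h : {linear subvs_of t -> dual t} := HB.pack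
  (fun n : subvs_of t => linfun (f n) : dual t) L1.
by rewrite /killing_iso (lfunE h) (lfunE (f nu)).
Qed.

(* (_ ^-1)%VF is a right inverse on the image, hence the inverse when the
   Killing form is nondegenerate on t. *)
Definition killing_dual t (mu mu' : dual t) : F :=
  killing (vsval ((killing_iso t)^-1%VF mu))
          (vsval ((killing_iso t)^-1%VF mu')).

Definition highest_weight t (Pos : set (dual t)) (V : vectType F)
    (rho : 'Hom(g, 'End(V))) (lambda : dual t) :=
  exists v, [/\ v != 0, v \in weight_space rho lambda
    & forall alpha, Pos alpha ->
      forall x, x \in weight_space ad alpha -> rho x v = 0].

(* Dominant integral weights: the values on the positive coroots
   2 alpha / (alpha, alpha) are natural numbers. *)
Definition dominant_weight t (Pos : set (dual t)) (lambda : dual t) :=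
  forall alpha, Pos alpha -> exists n : nat,
    2 * killing_dual lambda alpha / killing_dual alpha alpha = n%:R.

Definition half_sum t (Pos : set (dual t)) : dual t :=
  2^-1 *: \sum_(alpha \in Pos) alpha.

End LieAlgebras.

(* Over a numFieldType, 0 < z means that z is real and positive: Pos is the
   set of roots that are positive at a regular element h on which all the
   roots take real values. *)
Definition positive_roots (F : numFieldType) (g : lieAlgType F)
    (t : {vspace g}) (Pos : set (dual t)) :=
  exists h : subvs_of t,
    (forall alpha, roots alpha ->
       (alpha h : F) \is Num.real /\ (alpha h : F) != 0) /\
    Pos = [set alpha | roots alpha /\ 0 < (alpha h : F)].

(* Polynomial functions on U: the subalgebra of U -> F generated by the linear
   forms. *)
Inductive polyfun (F : fieldType) (U : vectType F) : (U -> F) -> Prop :=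
| polyfun_cst (c : F) : polyfun (cst c)
| polyfun_lin (l : 'Hom(U, F^o)) : polyfun (fun u => l u)
| polyfun_add (p q : U -> F) : polyfun p -> polyfun q -> polyfun (p + q)
| polyfun_mul (p q : U -> F) : polyfun p -> polyfun q -> polyfun (p * q).

Section PowerSums.
Context (F : fieldType) (g : lieAlgType F) (t : {vspace g}).
Implicit Types (Pos : set (dual t)) (P f : dual t * subvs_of t -> F).

(* P is a polynomial function of lambda with values in the homogeneous
   polynomials of degree k in nu, and P lambda is the k-th power sum of the
   weights of the irreducible representation of highest weight lambda. *)
Definition extends_power_sum Pos (k : nat) P :=
  [/\ polyfun P,
      forall mu c nu, P (mu, c *: nu) = c ^+ k * P (mu, nu)
    & forall lambda, dominant_weight Pos lambda ->
      forall (V : vectType F) (phi : 'Hom(g, 'End(V))),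
        representation phi -> irreducible_rep phi ->
        highest_weight Pos phi lambda ->
        forall nu, P (lambda, nu) = power_sum k phi nu].

Definition q2 (nu : subvs_of t) : F := killing (vsval nu) (vsval nu).

Definition q2_dual (mu : dual t) : F := killing_dual mu mu.

Definition translate (delta : dual t) f : dual t * subvs_of t -> F :=
  fun p => f (p.1 + delta, p.2).

End PowerSums.
Arguments q2 {F g t}.
Arguments q2_dual {F g t}.

(* Main.v *)
Require Import Defs.
From HB Require Import structures.
From mathcomp Require Import all_boot all_order all_algebra.
From mathcomp Require Import boolp classical_sets functions cardinality fsbigop.
From mathcomp Require Import reals complex.
From mathcomp Require Import ring.

(** Let V be irreducible of highest weight lambda.  V is the sum of its weight
    spaces, so the k-th power sum of its weights at nu is the trace of rho(nu)^k.
    The trace of rho vanishes on brackets, hence on the perfect algebra g.  Since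
    g is simple, the trace form of rho is c K for some scalar c, so the Casimir
    operator of K has trace c dim g; it also acts on V by the scalar
    K^(lambda + delta, lambda + delta) - K^(delta, delta).  Comparing the two
    values gives the formula at lambda.

    It extends to all weights because the highest weights of finite-dimensional
    representations are Zariski dense: they form a monoid (tensor products), and
    they span the dual of t.  Indeed, if a set S of weight vectors in a basis of g
    is closed under passing to larger weights, then the wedge of S is a highest
    weight vector in an exterior power of g; two such sets that differ by one
    element give each root as a difference of highest weights.

    The structure theory of g (nondegeneracy of K, toral Cartan subalgebras,
    alpha(t_alpha) <> 0) uses one device in place of Cartan's criterion and Lie's
    theorem: if f-bar acts on the generalized eigenspace of f for c by the
    conjugate of c, then tr (f o f-bar) is the sum of |c|^2 with multiplicities,
    so f is nilpotent when this trace vanishes; and for f = ad x, f-bar is a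
    derivation, since conjugation is additive. *)

Set Implicit Arguments.
Unset Strict Implicit.
Unset Printing Implicit Defensive.

Import Order.TTheory GRing.Theory Num.Theory.
Import passmx.
Local Open Scope ring_scope.

(** * Traces of endomorphisms *)

Section Lfun.
Context (F : fieldType) (U V : vectType F) (f : 'Hom(U, V)).

Lemma lfunD u v : f (u + v) = f u + f v. Proof. exact: linearD. Qed.
Lemma lfunB u v : f (u - v) = f u - f v. Proof. exact: linearB. Qed.
Lemma lfunN v : f (- v) = - f v. Proof. exact: linearN. Qed.
Lemma lfunZ c v : f (c *: v) = c *: f v. Proof. exact: linearZ. Qed.
Lemma lfun_sum I (r : seq I) (P : pred I) (u : I -> U) :
  f (\sum_(i <- r | P i) u i) = \sum_(i <- r | P i) f (u i).
Proof. exact: linear_sum. Qed.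

End Lfun.

Section Trace.
Context (F : fieldType) (V : vectType F).
Implicit Types (f g : 'End(V)).

Lemma lftraceD f g : lftrace (f + g) = lftrace f + lftrace g.
Proof. by rewrite /lftrace linearD mxtraceD. Qed.

Lemma lftraceZ a f : lftrace (a *: f) = a * lftrace f.
Proof. by rewrite /lftrace linearZ mxtraceZ. Qed.

Lemma lftrace0 : lftrace (0 : 'End(V)) = 0.
Proof. by rewrite /lftrace linear0 mxtrace0. Qed.

Lemma lftrace_sum I (r : seq I) (f : I -> 'End(V)) :
  lftrace (\sum_(i <- r) f i) = \sum_(i <- r) lftrace (f i).
Proof.
by elim/big_rec2: _ => [|i y x _ <-]; rewrite ?lftrace0 // lftraceD.
Qed.

Lemma lftraceB f g : lftrace (f - g) = lftrace f - lftrace g.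
Proof. by rewrite -scaleN1r lftraceD lftraceZ mulN1r. Qed.

Lemma lftraceC (W : vectType F) (f : 'Hom(V, W)) (g : 'Hom(W, V)) :
  lftrace (f \o g)%VF = lftrace (g \o f)%VF.
Proof.
have bV := vbasisP {:V}; have bW := vbasisP {:W}.
by rewrite /lftrace (mxof_comp _ _ bW) (mxof_comp _ _ bV) mxtrace_mulC.
Qed.

Lemma lftrace_basis n (e : n.-tuple V) f : basis_of {:V} e ->
  lftrace f = \sum_i coord e i (f e`_i).
Proof.
move=> be; have En := size_basis be; case: n / En e be => e be.
have bV := vbasisP {:V}.
have -> : lftrace f = \tr (mxof e e f).
  rewrite /lftrace -[f in LHS]comp_lfun1r.
  rewrite (mxof_comp _ _ be) mxtrace_mulC.
  by rewrite -mxof_comp // comp_lfun1l.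
apply: eq_bigr => i _.
by rewrite mxE /= vecof_delta mxE.
Qed.

Lemma lftrace_id : lftrace (\1%VF : 'End(V)) = (\dim {:V})%:R.
Proof. by rewrite /lftrace mxof1 ?(basis_free (vbasisP _)) ?mxtrace1. Qed.

(** The number is the rank. Having the trace of a projection as a natural number is what later makes
    the sum of the |c|^2 a sum of nonnegative terms. *)
Lemma lftrace_idem f : (f \o f)%VF = f ->
  exists2 n : nat, lftrace f = n%:R & (n = 0 -> f = 0).
Proof.
move=> ff; have bV := vbasisP {:V}.
set A := mxof (vbasis {:V}) (vbasis {:V}) f.
have AA : A *m A = A by rewrite -mxof_comp // ff.
exists (\rank A); last first.
  by move=> /eqP; rewrite mxrank_eq0 mxof_eq0 // => /eqP.
have /row_freeP[B BE] : row_free (row_base A) by apply: row_base_free.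
have /row_fullP[D DE] : row_full (col_base A) by apply: col_base_full.
(* In [Q P Q P = Q P], cancelling a left inverse of [Q] and a right inverse of [P] leaves [P Q = 1],
   of size the rank. *)
have PQ r (P : 'M_(r, _)) (Q : 'M_(_, r)) D' B' : Q *m P = A ->
    D' *m Q = 1%:M -> P *m B' = 1%:M -> P *m Q = 1%:M.
  move=> AE D'E B'E; have := congr2 (fun X Y => D' *m X *m Y) AA (erefl B').
  rewrite /= -AE !mulmxA D'E mul1mx -!mulmxA B'E mulmx1; apply.
have -> : lftrace f = \tr (col_base A *m row_base A) by rewrite mulmx_base.
by rewrite mxtrace_mulC (PQ _ _ _ _ _ (mulmx_base A) DE BE) mxtrace1.
Qed.

End Trace.

(** All roots of the characteristic polynomial are 0, so it is a power of 'X, and the trace is read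
    off its subleading coefficient. *)
Lemma lftrace_nil (C : closedFieldType) (V : vectType C) (f : 'End(V)) :
  (forall v, exists k, iter k f v = 0) -> lftrace f = 0.
Proof.
move=> fk; have bV := vbasisP {:V}.
rewrite /lftrace; set A := mxof _ _ _.
case: (posnP (\dim {:V})) => [n0|n0].
  rewrite /mxtrace big1 // => i _; exfalso.
  by have := leq_ltn_trans (leq0n i) (ltn_ord i); rewrite n0.
have := char_poly_trace A n0.
have [rs Ars] := closed_field_poly_normal (char_poly A).
have mA := char_poly_monic A.
rewrite (monicP mA) scale1r in Ars.
have rs0 r : r \in rs -> r = 0.
  move=> rrs; have : root (char_poly A) r.
    by rewrite Ars root_prod_XsubC.
  rewrite -eigenvalue_root_char => /eigenvalueP [u uA u0].
  have fv : f (vecof (vbasis {:V}) u) = r *: vecof (vbasis {:V}) u.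
    by rewrite (hom_vecof _ bV) uA linearZ.
  have iv j : iter j f (vecof (vbasis {:V}) u)
     = r ^+ j *: vecof (vbasis {:V}) u.
    by elim: j => [|j /= ->]; rewrite ?scale1r // linearZ /= fv scalerA exprSr.
  have [k] := fk (vecof (vbasis {:V}) u); rewrite iv => /eqP.
  rewrite scaler_eq0 vecof_eq0 ?(negPf u0) ?orbF //.
  by rewrite expf_eq0 => /andP[_ /eqP].
have -> : char_poly A = 'X^(\dim {:V}).
  have -> : char_poly A = \prod_(z <- rs) 'X.
    rewrite Ars !big_seq; apply: eq_bigr => r /rs0 ->; by rewrite subr0.
  have : size (char_poly A) = (\dim {:V}).+1 by rewrite size_char_poly.
  rewrite Ars size_prod_XsubC => -[<-].
  by rewrite big_const_seq count_predT iter_mulr_1.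
rewrite coefXn ltn_eqF ?prednK // => /eqP; rewrite eq_sym oppr_eq0 => /eqP.
by rewrite /lftrace.
Qed.

(** * Spectral projections *)

Section PolyEval.
Context (F : fieldType) (V : vectType F).

Lemma poly_eval (f : 'End(V)) : exists ev : {poly F} -> 'End(V),
  [/\ (forall p q, ev (p + q) = ev p + ev q),
      (forall p q, ev (p * q) = (ev p \o ev q)%VF),
      (forall c, ev c%:P = c *: \1%VF), ev 'X = f
    & forall g, (f \o g = g \o f)%VF -> forall p, (ev p \o g = g \o ev p)%VF].
Proof.
(* On the zero space all endomorphisms coincide and the zero map serves; otherwise they form a
   nontrivial algebra in which polynomials can be evaluated. *)
have [V0|V0] := posnP (dim V).
  have E0 (h : 'End(V)) : h = 0.
    apply/lfunP => v; have : v \in fullv by exact: memvf.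
    have /eqP : \dim {:V} = 0%N by rewrite dimvf.
    rewrite dimv_eq0 => /eqP ->; rewrite memv0 => /eqP ->.
    by rewrite !linear0.
  by exists (fun=> 0); split=> *; rewrite ?(E0 (0 \o _)%VF) ?(E0 (_ \o 0)%VF)
     ?[LHS]E0 ?[RHS]E0.
pose A := lfun_algType V0; exists (fun p => horner_alg (f : A) p).
have evM p q : horner_alg (f : A) (p * q)
    = (horner_alg (f : A) p \o horner_alg (f : A) q)%VF.
  by rewrite mulrC rmorphM.
have evX : horner_alg (f : A) 'X = f by rewrite horner_algX.
have evC c : horner_alg (f : A) c%:P = c *: \1%VF by rewrite horner_algC.
have evD p q : horner_alg (f : A) (p + q)
    = (horner_alg (f : A) p : 'End(V)) + horner_alg (f : A) q.
  by rewrite rmorphD.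
split=> // g fg; elim/poly_ind => [|p c IH].
  by rewrite -[0](polyC0) evC scale0r comp_lfun0l comp_lfun0r.
rewrite evD evC evM evX comp_lfunDl comp_lfunDr.
rewrite -comp_lfunA fg !comp_lfunA IH; congr (_ + _).
by rewrite -comp_lfunZl -comp_lfunZr comp_lfun1l comp_lfun1r.
Qed.

(** With [N] the dimension of 'End(V), the [N.+1] images of 1, 'X, ..., 'X^N are linearly
    dependent. *)
Lemma poly_annul (ev : {poly F} -> 'End(V)) :
  (forall p q, ev (p + q) = ev p + ev q) ->
  (forall p q, ev (p * q) = (ev p \o ev q)%VF) ->
  (forall c, ev c%:P = c *: \1%VF) -> exists2 p, p != 0 & ev p = 0.
Proof.
move=> evD evM evC; set N := \dim {:'End(V)}.
pose X := [tuple ev 'X^i | i < N.+1].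
have evs n (k : nat -> F) :
    ev (\sum_(i < n) k i *: 'X^i) = \sum_(i < n) k i *: ev 'X^i.
  elim: n => [|n IH]; first by rewrite !big_ord0 -[0](polyC0) evC scale0r.
  rewrite !big_ord_recr /= evD IH -mul_polyC evM evC; congr (_ + _).
  by rewrite -comp_lfunZl comp_lfun1l.
have nf : ~~ free X.
  apply/negP => /eqP; rewrite size_tuple => XN.
  by have := dimvS (subvf <<X>>); rewrite XN ltnn.
have [k kX [i ki]] : exists2 k : 'I_N.+1 -> F, \sum_(i < N.+1) k i *: X`_i = 0 &
    exists i, k i != 0.
  apply: contrapT => H; case/negP: nf; apply/freeP => k kX i.
  by apply/eqP; apply: contrapT => /negP ki; apply: H; exists k => //; exists i.
exists (\poly_(i < N.+1) k (inord i)).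
  apply/eqP => /(congr1 (fun p : {poly F} => p`_i)).
  by rewrite coef_poly ltn_ord inord_val coef0; apply/eqP.
rewrite poly_def (evs _ (fun i => k (inord i))) -[RHS]kX.
apply: eq_bigr => j _; rewrite inord_val; congr (_ *: _).
by rewrite (nth_map j) ?size_enum_ord ?nth_ord_enum // ltn_ord.
Qed.

End PolyEval.

Section Spectral.
Context (C : closedFieldType) (V : vectType C).
Implicit Types (f g : 'End(V)) (c d : C).

Definition gen_eigen f c v := exists n, iter n (f - c *: \1)%VF v = 0.

Lemma shiftE f c v : (f - c *: \1)%VF v = f v - c *: v.
Proof. by rewrite add_lfunE opp_lfunE scale_lfunE id_lfunE. Qed.

Lemma iter_lfun0 f n : iter n f 0 = 0.
Proof. by elim: n => //= n ->; rewrite linear0. Qed.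

Lemma iter_lfunD f n u v : iter n f (u + v) = iter n f u + iter n f v.
Proof. by elim: n => //= n ->; rewrite linearD. Qed.

Lemma iter_comm f g n v : (f \o g = g \o f)%VF ->
  iter n f (g v) = g (iter n f v).
Proof.
by move=> fg; elim: n => //= n ->; rewrite -!comp_lfunE fg.
Qed.

(** Induction on the exponent for [c] reduces to a true eigenvector, on which [f - d] acts by the
    nonzero scalar [c - d]. *)
Lemma gen_eigen_disjoint f c d v : c != d ->
  gen_eigen f c v -> gen_eigen f d v -> v = 0.
Proof.
move=> cd [n]; elim: n v => // n IH v; rewrite iterSr => nv [m mv].
have fv : (f - c *: \1)%VF v = 0.
  apply: IH => //; exists m.
  rewrite iter_comm ?mv ?linear0 //; apply/lfunP => w.
  rewrite !comp_lfunE !shiftE !linearB !linearZ /= !scalerA [d * c]mulrC.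
  by rewrite !addrA; congr (_ + _); exact: addrAC.
have fE : (f - d *: \1)%VF v = (c - d) *: v.
  move/eqP: fv; rewrite !shiftE subr_eq0 => /eqP ->.
  by rewrite scalerBl.
have iE k : iter k (f - d *: \1)%VF v = (c - d) ^+ k *: v.
  elim: k => [|k /= ->]; rewrite ?scale1r // linearZ /= fE scalerA exprSr //.
move: mv; rewrite iE => /eqP; rewrite scaler_eq0 expf_eq0 subr_eq0.
by rewrite (negPf cd) andbF => /eqP.
Qed.

(** Chinese remainder theorem for the powers of distinct linear factors, with constants as
    prescribed residues. *)
Lemma crt_poly (cs : seq C) N (phi : C -> C) : uniq cs ->
  exists s : {poly C}, forall c, c \in cs -> ('X - c%:P) ^+ N %| s - (phi c)%:P.
Proof.
elim: cs => [|c cs IH] /=; first by exists 0.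
move=> /andP[cN /IH[s sP]].
pose M := \prod_(d <- cs) ('X - d%:P) ^+ N.
have : coprimep M (('X - c%:P) ^+ N).
  rewrite /M big_seq coprimep_sym; apply: (big_ind (coprimep _)) => [|p q|d dcs].
  - exact: coprimep1.
  - by rewrite coprimepMr => -> ->.
  apply: coprimep_expl; apply: coprimep_expr.
  rewrite coprimep_XsubC rootE !hornerE subr_eq0.
  by apply: contraNneq cN => <-.
case/Bezout_eq1_coprimepP => -[u v] /= uv.
(* Modulo [M] the correction vanishes; modulo the new factor [u * M] is 1, so the residue becomes
   [phi c]. *)
exists (s + u * M * ((phi c)%:P - s)) => d; rewrite inE => /orP[/eqP ->|dcs].
  have -> : s + u * M * ((phi c)%:P - s) - (phi c)%:P
      = (s - (phi c)%:P) * (v * ('X - c%:P) ^+ N).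
    have -> : v * ('X - c%:P) ^+ N = 1 - u * M.
      by rewrite -uv addrAC subrr add0r.
    by rewrite [RHS]mulrBr mulr1 -(opprB s) mulrN [X in _ - X - _]mulrC addrAC.
  by rewrite mulrA dvdp_mull.
rewrite addrAC dvdp_add ?sP //; apply: dvdp_mulr; apply: dvdp_mull.
by rewrite /M (big_rem d) //= dvdp_mulr.
Qed.

Lemma prodX_dvdp (cs : seq C) N (q : {poly C}) : uniq cs ->
  (forall c, c \in cs -> ('X - c%:P) ^+ N %| q) ->
  \prod_(c <- cs) ('X - c%:P) ^+ N %| q.
Proof.
elim: cs => [|c cs IH] /=; first by rewrite big_nil dvd1p.
move=> /andP[cN ucs] cq; rewrite big_cons Gauss_dvdp.
  rewrite cq ?mem_head //= IH // => d dcs.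
  by apply: cq; rewrite inE dcs orbT.
rewrite big_seq; apply: (big_ind (coprimep _)) => [|p q'|d dcs].
- exact: coprimep1.
- by rewrite coprimepMr => -> ->.
apply: coprimep_expl; apply: coprimep_expr.
rewrite coprimep_XsubC rootE !hornerE subr_eq0.
by apply: contraNneq cN => <-.
Qed.

(** The projections are polynomials in [f], obtained from the remainder theorem with indicator
    residues; hence they commute with everything that commutes with [f]. *)
Lemma spectral_proj f : exists (cs : seq C) (p : C -> 'End(V)) (N : nat),
  [/\ uniq cs, \sum_(c <- cs) p c = \1%VF,
      forall g, (f \o g = g \o f)%VF -> forall c, (p c \o g = g \o p c)%VF
    & forall c v, c \in cs -> iter N (f - c *: \1)%VF (p c v) = 0].
Proof.
have [ev [evD evM evC evX evcomm]] := poly_eval f.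
have [q q0 evq] := poly_annul evD evM evC.
have [rs rsE] := closed_field_poly_normal q.
(* Each root of the annihilating polynomial has multiplicity at most [N], so that polynomial divides
   [M]. *)
pose cs := undup rs; pose N := size rs.
have ucs : uniq cs by apply: undup_uniq.
pose M := \prod_(c <- cs) ('X - c%:P) ^+ N.
have evdvd h : M %| h -> ev h = 0.
  have qM : q %| M.
    rewrite rsE dvdpZl ?lead_coef_eq0 // -big_undup_iterop_count /=.
    rewrite /M !big_seq.
    apply: (big_ind2 (fun a b => a %| b)) => [|a b a' b'|c crs].
    - exact: dvdpp.
    - exact: dvdp_mul.
    rewrite -/(_ ^+ _) dvdp_exp2l // /N; exact: count_size.
  move=> /(dvdp_trans qM)/dvdpP[k ->].
  by rewrite evM evq comp_lfun0r.
pose s c := sval (cid (crt_poly N (fun d => (d == c)%:R) ucs)).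
have sP c d : d \in cs -> ('X - d%:P) ^+ N %| s c - (d == c)%:R%:P.
  by move=> dcs; rewrite /s; case: cid => /= s0; apply.
have ev0 : ev 0 = 0 by rewrite -(polyC0 C) evC scale0r.
exists cs, (ev \o s), N; split=> //.
- have evs : \sum_(c <- cs) ev (s c) = ev (\sum_(c <- cs) s c).
    by elim/big_rec2: _ => [|i y x _ ->]; rewrite ?ev0 ?evD.
  rewrite [LHS]evs; apply/eqP; rewrite -subr_eq0; apply/eqP.
  have -> : \1%VF = ev 1 by rewrite -(polyC1 C) evC scale1r.
  have evN h : - ev h = ev (- h).
    by apply/eqP; rewrite eq_sym -subr_eq0 opprK -evD addNr ev0.
  rewrite evN -evD; apply: evdvd; apply: prodX_dvdp => // d dcs.
  have -> : 1 = \sum_(c <- cs) (d == c)%:R%:P :> {poly C}.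
    rewrite (bigD1_seq d) //= eqxx big1 ?addr0 // => c.
    by rewrite eq_sym => /negPf ->.
  rewrite -sumrB; apply: (big_ind (fun h => _ %| h)) => [|a b|c _].
  - exact: dvdp0.
  - exact: dvdp_add.
  exact: sP.
- by move=> g fg c; apply: evcomm.
- move=> c v ccs.
  have evXc : ev ('X - c%:P) = f - c *: \1%VF.
    by rewrite evD evX -polyCN evC scaleNr.
  have it k : iter k (f - c *: \1)%VF (ev (s c) v)
      = ev (('X - c%:P) ^+ k * s c) v.
    elim: k => [|k /= ->]; first by rewrite expr0 mul1r.
    by rewrite exprS -mulrA [in RHS]evM comp_lfunE evXc.
  rewrite [LHS]it evdvd ?zero_lfunE //; apply: prodX_dvdp => // d dcs.
  have [->|dc] := eqVneq d c; first exact: dvdp_mulr.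
  apply: dvdp_mull; have := sP c d dcs; rewrite (negPf dc).
  by rewrite subr0.
Qed.

End Spectral.

Section SpectralMap.
Context (C : closedFieldType) (V : vectType C).
Implicit Types (f g : 'End(V)) (c d : C) (u v w : V).

Lemma gen_eigen0 f c : gen_eigen f c 0.
Proof. by exists 0%N. Qed.

Lemma gen_eigen_sum f c I (r : seq I) (P : pred I) (u : I -> V) :
  (forall i, P i -> gen_eigen f c (u i)) -> gen_eigen f c (\sum_(i <- r | P i) u i).
Proof.
apply: (big_ind (gen_eigen f c)) => [|x y [n xn] [m ym]]; first exact: gen_eigen0.
exists (n + m)%N; rewrite iter_lfunD [X in _ + X]iterD ym addnC iterD xn.
by rewrite !iter_lfun0 addr0.
Qed.

Lemma gen_eigen_zero f v : gen_eigen f 0 v <-> exists n, iter n f v = 0.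
Proof. by rewrite /gen_eigen scale0r subr0. Qed.

Lemma gen_eigen_decomp f : exists (cs : seq C) (p : C -> 'End(V)),
  [/\ uniq cs, forall v, v = \sum_(c <- cs) p c v,
      forall g, (f \o g = g \o f)%VF -> forall c, (p c \o g = g \o p c)%VF
    & forall c v, c \in cs -> gen_eigen f c (p c v)].
Proof.
have [cs [p [N [ucs p1 pc pg]]]] := spectral_proj f.
exists cs, p; split=> // [v|c v ccs]; last by exists N; apply: pg.
by rewrite -sum_lfunE p1 id_lfunE.
Qed.

Lemma shift_comm f g c : (f \o g = g \o f)%VF ->
  ((f - c *: \1) \o g = g \o (f - c *: \1))%VF.
Proof.
move=> fg; apply/lfunP => v.
by rewrite !comp_lfunE !shiftE lfunB lfunZ -!comp_lfunE fg.
Qed.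

Lemma gen_eigen_comm f g c v : (f \o g = g \o f)%VF ->
  gen_eigen f c v -> gen_eigen f c (g v).
Proof.
move=> fg [n nv]; exists n; rewrite iter_comm ?nv ?linear0 //.
exact: shift_comm.
Qed.

(** [D] is the sum of the [phi c *: p c] over the spectral projections. For [c] in [cs], [r c] is
    the trace of [p c] as a natural number; if it vanishes for all nonzero [c], only the generalized
    0-eigenspace remains. *)
Lemma spectral_map f (phi : C -> C) : exists D : 'End(V),
  [/\ forall c v, gen_eigen f c v -> D v = phi c *: v,
      forall g, (f \o g = g \o f)%VF -> (D \o g = g \o D)%VF
    & exists (cs : seq C) (r : C -> nat),
        lftrace (f \o D)%VF = \sum_(c <- cs) c * phi c * (r c)%:R
      /\ ((forall c, c \in cs -> c != 0 -> r c = 0%N) -> forall v, gen_eigen f 0 v)].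
Proof.
have [cs [p [N [ucs p1 pcomm pnil]]]] := spectral_proj f.
have pge c v : c \in cs -> gen_eigen f c (p c v) by exists N; apply: pnil.
have pE v : v = \sum_(c <- cs) p c v by rewrite -sum_lfunE p1 id_lfunE.
have p0 c d v : c \in cs -> gen_eigen f d v -> c != d -> p c v = 0.
  move=> ccs vd cd; apply: (gen_eigen_disjoint cd (pge _ _ ccs)).
  by apply: gen_eigen_comm => //; rewrite pcomm.
have ppc c v : c \in cs -> gen_eigen f c v -> p c v = v.
  move=> ccs vc; rewrite [RHS]pE (bigD1_seq c) //= big_seq_cond big1 ?addr0 //.
  by move=> d /andP[dcs dc]; apply: p0 dc.
pose D := \sum_(c <- cs) phi c *: p c.
have DE v : D v = \sum_(c <- cs) phi c *: p c v.
  by rewrite sum_lfunE; apply: eq_bigr => c _; rewrite scale_lfunE.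
exists D; split.
- move=> c v vc; rewrite DE [in RHS](pE v) scaler_sumr !big_seq.
  apply: eq_bigr => d dcs; have [->//|dc] := eqVneq d c.
  by rewrite (p0 d c) // !scaler0.
- move=> g fg; apply/lfunP => v; rewrite !comp_lfunE !DE linear_sum /=.
  by apply: eq_bigr => c _; rewrite lfunZ -!comp_lfunE pcomm.
(* The default 0 concerns values outside [cs], where nothing is known about [p c]. *)
pose r c := if pselect ((p c \o p c)%VF = p c) is left e
  then s2val (cid2 (lftrace_idem e)) else 0%N.
have rP c : c \in cs -> lftrace (p c) = (r c)%:R /\ (r c = 0%N -> p c = 0).
  move=> ccs; rewrite /r; case: pselect => [e|[]]; first by case: cid2.
  by apply/lfunP => v; rewrite comp_lfunE ppc //; apply: pge.
exists cs, r; split.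
  have -> : (f \o D)%VF = \sum_(c <- cs) phi c *: (f \o p c)%VF.
    apply/lfunP => v; rewrite comp_lfunE DE linear_sum /= sum_lfunE.
    by apply: eq_bigr => c _; rewrite scale_lfunE comp_lfunE lfunZ.
  rewrite lftrace_sum !big_seq; apply: eq_bigr => c ccs.
  rewrite lftraceZ -(rP c ccs).1 mulrAC mulrC; congr (_ * _).
  (* The trace of [f \o p c] is [c] times that of [p c], because the difference is nilpotent. The
     exponent is [N.+1] since the formula for iterates starts at the first power. *)
  apply/eqP; rewrite -subr_eq0 -lftraceZ -lftraceB; apply/eqP.
  apply: lftrace_nil => v; exists N.+1.
  have E w : (f \o p c - c *: p c)%VF w = p c ((f - c *: \1)%VF w).
    rewrite add_lfunE opp_lfunE scale_lfunE !comp_lfunE -!comp_lfunE -pcomm //.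
    by rewrite !comp_lfunE shiftE lfunB lfunZ.
  have cs' : (f \o (f - c *: \1) = (f - c *: \1) \o f)%VF.
    by rewrite shift_comm.
  have shp w : (f - c *: \1)%VF (p c w) = p c ((f - c *: \1)%VF w).
    by rewrite -comp_lfunE (shift_comm _ (esym (pcomm f erefl c))) comp_lfunE.
  have itE k : iter k.+1 (f \o p c - c *: p c)%VF v
      = p c (iter k.+1 (f - c *: \1)%VF v).
    elim: k => [|k IH]; first by rewrite /= E.
    rewrite iterS IH E shp ppc //; exact: pge.
  rewrite itE -iter_comm ?iterS ?pnil ?linear0 //.
  exact: shift_comm (esym (pcomm f erefl c)).
move=> r0 v; rewrite (pE v) big_seq; apply: gen_eigen_sum => c ccs.
have [c0|c0] := eqVneq c 0; first by rewrite -c0; apply: pge.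
by rewrite (rP c ccs).2 ?r0 // zero_lfunE; apply: gen_eigen0.
Qed.

Definition semisimple_lfun f := forall c v, gen_eigen f c v -> f v = c *: v.

(** Jordan decomposition: [spectral_map] for the identity function. The eigenspaces of [D] are
    exactly the generalized eigenspaces of [f]. *)
Lemma semisimple_part f : exists D : 'End(V),
  [/\ forall c v, gen_eigen f c v -> D v = c *: v,
      forall c v, D v = c *: v -> gen_eigen f c v,
      semisimple_lfun D & forall v, gen_eigen (f - D) 0 v].
Proof.
have [D [DE Dc _]] := spectral_map f id; exists D.
have [cs [p [ucs pE pcomm pge]]] := gen_eigen_decomp f.
have fD : (f \o D = D \o f)%VF by rewrite Dc.
have Dp c d v : d \in cs -> gen_eigen D c v -> d != c -> p d v = 0.
  move=> dcs vc dc; apply: (gen_eigen_disjoint (f := D) dc); last first.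
    by apply: gen_eigen_comm => //; rewrite pcomm.
  by exists 1%N; rewrite /= shiftE (DE _ _ (pge _ v dcs)) subrr.
have eigD c v : D v = c *: v -> gen_eigen D c v.
  by move=> Dv; exists 1%N; rewrite /= shiftE Dv subrr.
split=> // [c v /eigD vc|c v vc|v].
- rewrite (pE v) big_seq; apply: gen_eigen_sum => d dcs.
  have [<-|dc] := eqVneq d c; first exact: pge.
  by rewrite (Dp c d) //; apply: gen_eigen0.
- rewrite {2}(pE v) scaler_sumr {1}(pE v) lfun_sum !big_seq.
  apply: eq_bigr => d dcs; rewrite (DE _ _ (pge _ v dcs)).
  by have [->//|dc] := eqVneq d c; rewrite (Dp c d) // !scaler0.
rewrite (pE v) big_seq; apply: gen_eigen_sum => d dcs.
have [n pn] := pge _ v dcs; apply/gen_eigen_zero; exists n; rewrite -{}pn.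
elim: n (p d v) (pge _ v dcs) => // n IH w wd; rewrite !iterSr -IH.
  by rewrite shiftE add_lfunE opp_lfunE (DE _ _ wd).
by apply: gen_eigen_comm => //; rewrite shift_comm.
Qed.

(** The vector is split by one map at a time; the spectral projections of that map commute with the
    others and so preserve their eigenvectors. *)
Lemma joint_eigen (fs : seq 'End(V)) :
  (forall f, f \in fs -> semisimple_lfun f) ->
  (forall f g, f \in fs -> g \in fs -> (f \o g = g \o f)%VF) ->
  forall v, exists2 ws : seq V, v = \sum_(w <- ws) w &
    forall w f, w \in ws -> f \in fs -> exists c, f w = c *: w.
Proof.
elim: fs => [|f fs IH] df cf v; first by exists [:: v]; rewrite ?big_seq1.
have [||ws vws wsP] := IH _ _ v.
- by move=> g gfs; apply: df; rewrite inE gfs orbT.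
- by move=> g h gfs hfs; apply: cf; rewrite inE ?gfs ?hfs orbT.
have [cs [p [ucs pE pcomm pge]]] := gen_eigen_decomp f.
exists [seq p c w | w <- ws, c <- cs].
  rewrite big_allpairs_dep vws; apply: eq_bigr => w _; exact: pE.
move=> _ g /allpairsP[[w c] /= [wws ccs ->]]; rewrite inE => /orP[/eqP ->|gfs].
  by exists c; apply: df; rewrite ?mem_head //; apply: pge.
have [d gw] := wsP w g wws gfs; exists d.
rewrite -comp_lfunE -pcomm ?comp_lfunE ?gw ?linearZ //.
by apply: cf; rewrite ?mem_head // inE gfs orbT.
Qed.

End SpectralMap.

Lemma conj_nilpotent (C : numClosedFieldType) (V : vectType C) (f : 'End(V)) :
  exists D : 'End(V),
  [/\ forall c v, gen_eigen f c v -> D v = c^* *: v,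
      forall g, (f \o g = g \o f)%VF -> (D \o g = g \o D)%VF
    & lftrace (f \o D)%VF = 0 -> forall v, gen_eigen f 0 v].
Proof.
have [D [DE Dc [cs [r [tr nil]]]]] := spectral_map f Num.conj.
exists D; split=> // D0; apply: nil => c ccs c0.
(* The terms are [c * c^*] times a natural number, all nonnegative, so each of them vanishes. *)
move: D0; rewrite tr => /eqP; rewrite psumr_eq0; last first.
  by move=> d _; rewrite mulr_ge0 ?mul_conjC_ge0 ?ler0n.
move=> /allP/(_ c ccs)/=; rewrite !mulf_eq0 conjC_eq0 (negPf c0) /=.
by rewrite pnatr_eq0 => /eqP.
Qed.

(** * Lie algebras and Engel's theorem *)

Lemma span_ind (F : fieldType) (V : vectType F) (X : seq V) (P : V -> Prop) : P 0 ->
  (forall x y, P x -> P y -> P (x + y)) -> (forall c x, P x -> P (c *: x)) ->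
  (forall x, x \in X -> P x) -> forall x, x \in <<X>>%VS -> P x.
Proof.
move=> P0 PD PZ PX x; rewrite -[X]in_tupleE => /coord_span ->.
elim/big_rec: _ => // i y _ Py; apply: PD => //; apply: PZ.
by apply: PX; rewrite mem_nth.
Qed.

Section Brackets.
Context (F : fieldType) (g : lieAlgType F).
Implicit Types (x y z : g) (U W t : {vspace g}).

Lemma brDl x y z : bracket (x + y) z = bracket x z + bracket y z.
Proof. by rewrite -!adE lfunD add_lfunE. Qed.
Lemma brDr x y z : bracket x (y + z) = bracket x y + bracket x z.
Proof. by rewrite -!adE lfunD. Qed.
Lemma brZl c x y : bracket (c *: x) y = c *: bracket x y.
Proof. by rewrite -!adE lfunZ scale_lfunE. Qed.
Lemma brZr c x y : bracket x (c *: y) = c *: bracket x y.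
Proof. by rewrite -!adE lfunZ. Qed.
Lemma br0l y : bracket 0 y = 0 :> g.
Proof. by rewrite -adE linear0 zero_lfunE. Qed.
Lemma br0r y : bracket y 0 = 0 :> g.
Proof. by rewrite -adE linear0. Qed.
Lemma brNl x y : bracket (- x) y = - bracket x y.
Proof. by rewrite -!adE lfunN opp_lfunE. Qed.
Lemma brNr x y : bracket x (- y) = - bracket x y.
Proof. by rewrite -!adE lfunN. Qed.

Lemma brC x y : bracket x y = - bracket y x.
Proof.
have := @bracketxx _ g (x + y); rewrite brDl !brDr !bracketxx add0r addr0.
by move/eqP; rewrite addr_eq0 => /eqP.
Qed.

Lemma brJ x y z :
  bracket x (bracket y z) = bracket (bracket x y) z + bracket y (bracket x z).
Proof.
have := bracket_jacobi x y z.
rewrite [bracket z (bracket x y)]brC [bracket z x]brC brNr => /eqP.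
by rewrite subr_eq add0r subr_eq => /eqP.
Qed.

Lemma brsuml I (r : seq I) (P : pred I) (u : I -> g) y :
  bracket (\sum_(i <- r | P i) u i) y = \sum_(i <- r | P i) bracket (u i) y.
Proof. by apply: (big_morph (bracket^~ y)) => [a b|]; rewrite ?brDl ?br0l. Qed.
Lemma brsumr I (r : seq I) (P : pred I) (u : I -> g) y :
  bracket y (\sum_(i <- r | P i) u i) = \sum_(i <- r | P i) bracket y (u i).
Proof. by apply: (big_morph (bracket y)) => [a b|]; rewrite ?brDr ?br0r. Qed.

Lemma ad_rep : representation (ad g).
Proof.
move=> x y v; rewrite !adE; apply/eqP; rewrite eq_sym subr_eq; apply/eqP.
exact: brJ.
Qed.

Lemma repE (V : vectType F) (rho : 'Hom(g, 'End(V))) x y : representation rho ->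
  rho (bracket x y) = (rho x \o rho y)%VF - (rho y \o rho x)%VF.
Proof.
by move=> rr; apply/lfunP => v; rewrite rr add_lfunE opp_lfunE !comp_lfunE.
Qed.

Lemma mem_brv U W x y : x \in U -> y \in W -> bracket x y \in brv U W.
Proof.
move=> xU yW; rewrite (coord_vbasis xU) (coord_vbasis yW).
rewrite -adE lfun_sum; apply: memv_suml => j _.
rewrite lfun_sum sum_lfunE; apply: memv_suml => i _.
rewrite !lfunZ scale_lfunE adE; do 2 apply: memvZ.
apply/memv_span/allpairsP; exists ((vbasis U)`_i, (vbasis W)`_j).
by rewrite !mem_nth ?size_tuple.
Qed.

Lemma brv_sub U W (X : {vspace g}) :
  (forall x y, x \in U -> y \in W -> bracket x y \in X) -> (brv U W <= X)%VS.
Proof.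
move=> H; apply/span_subvP => _ /allpairsP[[x y] /= [xU yW ->]].
by apply: H; apply: vbasis_mem.
Qed.

Lemma brv_ind U W (P : g -> Prop) : P 0 -> (forall x y, P x -> P y -> P (x + y)) ->
  (forall c x, P x -> P (c *: x)) ->
  (forall x y, x \in U -> y \in W -> P (bracket x y)) ->
  forall x, x \in brv U W -> P x.
Proof.
move=> P0 PD PZ Pb x.
apply: span_ind => // _ /allpairsP[[a b] /= [aU bW ->]].
by apply: Pb; apply: vbasis_mem.
Qed.

(** The derived algebra is an ideal, and it is nonzero because some bracket is. *)
Lemma simple_perfect : simple_lie g -> brv fullv fullv = fullv :> {vspace g}.
Proof.
move=> [[x [y xy]] simp]; case: (simp (brv fullv fullv)) => //.
  by move=> a b _; apply: mem_brv; rewrite memvf.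
move=> b0; have := mem_brv (memvf x) (memvf y); rewrite b0 memv0.
by rewrite (negPf xy).
Qed.

End Brackets.

Section Engel.
Context (F : fieldType) (g : lieAlgType F).
Implicit Types (x y z : g) (U W t : {vspace g}).

(* Every tail of the sequence spans an ideal of the span of the next longer tail. *)
Fixpoint engel_seq (ys : seq g) :=
  if ys is y :: s then (forall z, z \in s -> bracket y z \in <<s>>%VS) /\ engel_seq s
  else True.

(** Engel's theorem modulo an invariant subspace [U] and inside an invariant class [P] of vectors. A
    vector good for the tail is moved by [y] up to the last iterate outside [U]. *)
Lemma engel (V : vectType F) (rho : 'Hom(g, 'End(V))) (ys : seq g)
    (P : V -> Prop) (U : {vspace V}) :
  representation rho -> engel_seq ys ->
  (forall y w, y \in ys -> P w -> P (rho y w)) ->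
  (forall y w, y \in ys -> w \in U -> rho y w \in U) ->
  (forall y w, y \in ys -> P w -> exists n, iter n (rho y) w \in U) ->
  (exists w, P w /\ w \notin U) ->
  exists w, [/\ P w, w \notin U & forall y, y \in ys -> rho y w \in U].
Proof.
move=> rr; elim: ys => [|y s IH] /=; first by move=> _ _ _ _ [w [Pw wU]]; exists w.
move=> [ys es] stP stU nil ex.
have inS z : z \in s -> z \in y :: s by rewrite inE orbC => ->.
have [|||//|w [Pw wU sw]] := IH es.
- by move=> z w /inS; apply: stP.
- by move=> z w /inS; apply: stU.
- by move=> z w /inS; apply: nil.
have yy : y \in y :: s by rewrite mem_head.
(* The iterates stay good for the tail: exchanging [y] and [z] costs the action of [bracket y z],
   which lies in the span of the tail. *)
have itP n : P (iter n (rho y) w) /\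
    forall z, z \in s -> rho z (iter n (rho y) w) \in U.
  elim: n => //= n [IP Is]; split; first exact: stP.
  move=> z zs; have := ys z zs.
  have -> : rho z (rho y (iter n (rho y) w))
      = rho y (rho z (iter n (rho y) w)) - rho (bracket y z) (iter n (rho y) w).
    by rewrite rr opprB addrC subrK.
  move=> yz; apply: memvB; first by apply: stU => //; apply: Is.
  move: (bracket y z) yz; apply: span_ind => [|a b|c a|a /Is //].
  - by rewrite linear0 zero_lfunE mem0v.
  - by rewrite lfunD add_lfunE; apply: memvD.
  - by rewrite lfunZ scale_lfunE; apply: memvZ.
have exn : exists n, iter n (rho y) w \in U by exact: nil.
case: (ex_minnP exn) => -[|n] nU min; first by rewrite nU in wU.
exists (iter n (rho y) w); split; first exact: (itP n).1.
  by apply/negP => /min; rewrite ltnn.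
by move=> z; rewrite inE => /orP[/eqP -> //|]; apply: (itP n).2.
Qed.

Lemma lower_central_sub t n : lie_subalgebra t ->
  (lower_central t n.+1 <= lower_central t n)%VS /\ (lower_central t n <= t)%VS.
Proof.
move=> st; elim: n => [|n [IH1 IH2]].
  by split=> //; apply: brv_sub => x y; apply: st.
split; last exact: subv_trans IH2.
apply: brv_sub => x y xt yt; apply: mem_brv => //.
by apply: (subvP IH1).
Qed.

(** Bases of the terms of the lower central series are concatenated, larger terms in front;
    bracketing with [t] moves each term into the next one. *)
Lemma engel_seq_exists t : lie_subalgebra t -> lie_nilpotent t ->
  exists2 ys, engel_seq ys & <<ys>>%VS = t.
Proof.
move=> st [m tm].
suff H k : (k <= m)%N ->
    exists2 ys, engel_seq ys & <<ys>>%VS = lower_central t (m - k).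
  by have [ys e s] := H m (leqnn m); exists ys => //; rewrite s subnn.
elim: k => [|k IH] km.
  by exists [::] => //; rewrite subn0 tm span_nil.
have [ys eys yst] := IH (ltnW km).
have jE : (m - k)%N = (m - k.+1).+1 by rewrite subnS prednK // subn_gt0.
move: yst; rewrite jE; set j := (m - k.+1)%N => yst.
have [s1 s2] := lower_central_sub j st.
exists (vbasis (lower_central t j) ++ ys).
  suff H (X : seq g) : {subset X <= lower_central t j} -> engel_seq (X ++ ys).
    by apply: H => x; apply: vbasis_mem.
  elim: X => //= y X IHX sX; split.
    move=> z zX; rewrite span_cat; apply: (subvP (addvSr _ _)).
    rewrite yst; apply: mem_brv.
      by apply: (subvP s2); apply: sX; rewrite mem_head.
    move: zX; rewrite mem_cat => /orP[zX|zys]; first by apply: sX; rewrite inE zX orbT.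
    by apply: (subvP s1); rewrite -yst memv_span.
  by apply: IHX => z zX; apply: sX; rewrite inE zX orbT.
rewrite span_cat (span_basis (vbasisP _)) yst; apply/addv_idPl; exact: s1.
Qed.

Lemma ad_nil_subalg t x y : lie_subalgebra t -> lie_nilpotent t ->
  x \in t -> y \in t -> exists n, iter n (ad g x) y = 0.
Proof.
move=> st [n tn] xt yt; exists n; apply/eqP; rewrite -memv0 -tn.
by elim: n {tn} => //= n IH; rewrite adE; apply: mem_brv.
Qed.

End Engel.

(** * Trace forms and derivations *)

Lemma lfun_exists (F : fieldType) (U V : vectType F) (f : U -> V) : linear f ->
  exists h : 'Hom(U, V), forall x, h x = f x.
Proof.
move=> lf; pose L := GRing.isSemilinear.Build F _ _ *:%R _ (GRing.semilinear_linear lf).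
pose h : {linear U -> V} := HB.pack f L.
by exists (linfun h) => x; rewrite (lfunE h).
Qed.

(** Nondegeneracy makes [T] injective, and the dual has the same dimension as [U]. *)
Lemma form_represent (F : fieldType) (U : vectType F) (T : 'Hom(U, 'Hom(U, F^o))) :
  (forall x, (forall y, T x y = 0) -> x = 0) ->
  forall l : 'Hom(U, F^o), exists x, T x = l.
Proof.
move=> nd l.
have T0 : lker T == 0%VS.
  apply/lker0P => x y Txy; apply/eqP; rewrite -subr_eq0; apply/eqP/nd => z.
  by rewrite lfunB Txy subrr zero_lfunE.
have lT : limg T = fullv.
  apply/eqP; rewrite eqEdim subvf limg_dim_eq ?(eqP T0) ?capv0 //.
  by rewrite !dimvf /dim /= muln1.
have : l \in limg T by rewrite lT memvf.
by case/memv_imgP => x _ ->; exists x.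
Qed.

Section TraceForm.
Context (F : fieldType) (g : lieAlgType F) (V : vectType F).
Context (rho : 'Hom(g, 'End(V))).
Implicit Types (x y z : g).

Definition trform x y : F := lftrace (rho x \o rho y)%VF.

Lemma trformC x y : trform x y = trform y x.
Proof. exact: lftraceC. Qed.

Lemma trformDl x y z : trform (x + y) z = trform x z + trform y z.
Proof. by rewrite /trform lfunD comp_lfunDl lftraceD. Qed.

Lemma trformZl c x z : trform (c *: x) z = c * trform x z.
Proof. by rewrite /trform lfunZ -comp_lfunZl lftraceZ. Qed.

Lemma trformDr x y z : trform z (x + y) = trform z x + trform z y.
Proof. by rewrite trformC trformDl !(trformC z). Qed.

Lemma trformZr c x z : trform z (c *: x) = c * trform z x.
Proof. by rewrite trformC trformZl (trformC z). Qed.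

Lemma trform_lfun : exists T : 'Hom(g, 'Hom(g, F^o)), forall x y, T x y = trform x y.
Proof.
have H x : exists h : 'Hom(g, F^o), forall y, h y = trform x y.
  by apply: lfun_exists => c y z; rewrite trformDr trformZr.
have [|T TE] := @lfun_exists _ g _ (fun x => sval (cid (H x))).
  move=> c x y; apply/lfunP => z; rewrite add_lfunE scale_lfunE.
  by do 3 case: cid => /= ? ->; rewrite trformDl trformZl.
by exists T => x y; rewrite TE; case: cid.
Qed.

Hypothesis rr : representation rho.

Lemma trform_inv x y z : trform (bracket x y) z = trform x (bracket y z).
Proof.
rewrite /trform !(repE _ _ rr) comp_lfunDl comp_lfunDr comp_lfunNl comp_lfunNr.
rewrite !lftraceB -!comp_lfunA; congr (_ - _).
by rewrite lftraceC -comp_lfunA.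
Qed.

Lemma lftrace_rep0 : brv fullv fullv = fullv :> {vspace g} ->
  forall x, lftrace (rho x) = 0.
Proof.
move=> per x; have : x \in brv fullv fullv by rewrite per memvf.
elim/brv_ind => {x} [|x y x0 y0|c x x0|x y _ _].
- by rewrite linear0 lftrace0.
- by rewrite lfunD lftraceD x0 y0 addr0.
- by rewrite lfunZ lftraceZ x0 mulr0.
- by rewrite (repE _ _ rr) lftraceB lftraceC subrr.
Qed.

End TraceForm.

(** * Derivations and the Killing form *)

Section Derivations.
Context (F : fieldType) (g : lieAlgType F).
Implicit Types (x y z : g) (D : 'End(g)).

Definition derivation D := forall x y,
  D (bracket x y) = bracket (D x) y + bracket x (D y).

Lemma killingE x y : killing x y = trform (ad g) x y.
Proof. by []. Qed.

Lemma killingC x y : killing x y = killing y x.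
Proof. exact: trformC. Qed.

Lemma killing_inv x y z : killing (bracket x y) z = killing x (bracket y z).
Proof. exact: trform_inv (ad_rep (g := g)) x y z. Qed.

Lemma derivation_ad D x : derivation D ->
  ad g (D x) = (D \o ad g x)%VF - (ad g x \o D)%VF.
Proof.
move=> dD; apply/lfunP => y; rewrite add_lfunE opp_lfunE !comp_lfunE !adE dD.
by rewrite addrK.
Qed.

Lemma ad_derivation x : derivation (ad g x).
Proof. by move=> y z; rewrite !adE brJ. Qed.

(** Since [ad (D y)] is the commutator of [D] and [ad y], this is cyclicity of the trace. It shows
    that the trace of [ad z] composed with [D] vanishes on brackets once the Killing form does. *)
Lemma lftrace_ad_derivation D x y : derivation D ->
  lftrace (ad g (bracket x y) \o D)%VF = - killing x (D y).
Proof.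
move=> dD; rewrite killingE /trform (derivation_ad y dD) (repE _ _ (ad_rep (g := g))).
rewrite comp_lfunDl comp_lfunDr comp_lfunNl comp_lfunNr !lftraceB opprB.
rewrite -!comp_lfunA; congr (_ - _).
by rewrite lftraceC -comp_lfunA.
Qed.

(* By invariance K (D x) y = tr (D o ad [x, y]). *)
Lemma derivation_trace D : derivation D ->
  (forall x, (forall y, killing x y = 0) -> x = 0) ->
  (forall y, lftrace (D \o ad g y)%VF = 0) -> D = 0.
Proof.
move=> dD nd D0; apply/lfunP => x; rewrite zero_lfunE; apply: nd => y.
rewrite killingE /trform (derivation_ad x dD) comp_lfunDl comp_lfunNl lftraceB.
have := D0 (bracket x y); rewrite (repE _ _ (ad_rep (g := g))) comp_lfunDr comp_lfunNr.
rewrite lftraceB !comp_lfunA => <-; congr (_ - _).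
by rewrite -[X in lftrace X = _]comp_lfunA; exact: lftraceC.
Qed.

(** Nondegeneracy represents the functional [y] to tr (D o ad y) by some [x]; the derivation
    [D - ad x] is then trace-orthogonal to every [ad y], hence zero. *)
Lemma derivation_inner D : derivation D ->
  (forall x, (forall y, killing x y = 0) -> x = 0) ->
  exists x, ad g x = D.
Proof.
move=> dD nd; have [T TE] := trform_lfun (ad g).
have [|l lE] := @lfun_exists _ g F^o (fun y => lftrace (D \o ad g y)%VF).
  move=> c x y; rewrite lfunD lfunZ comp_lfunDr -comp_lfunZr lftraceD lftraceZ.
  by [].
have [|x xE] := form_represent _ l (T := T).
  by move=> x xT; apply: nd => y; rewrite killingE -TE xT.
exists x; apply/eqP; rewrite eq_sym -subr_eq0; apply/eqP.
apply: derivation_trace => // [y z|y].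
  rewrite !add_lfunE !opp_lfunE dD ad_derivation brDl brDr brNl brNr.
  by rewrite opprD addrACA.
rewrite comp_lfunDl comp_lfunNl lftraceB -lE -xE TE; exact: subrr.
Qed.

End Derivations.

Section SpectralDerivation.
Context (C : closedFieldType) (g : lieAlgType C).
Implicit Types (x y z u v : g).

(** By the Leibniz rule [ad x - (a + b)] acts on a bracket as [ad x - a] on the left factor plus
    [ad x - b] on the right one; after [n + m] steps every term is exhausted. *)
Lemma gen_eigen_br x a b u v : gen_eigen (ad g x) a u -> gen_eigen (ad g x) b v ->
  gen_eigen (ad g x) (a + b) (bracket u v).
Proof.
move=> [n nu] [m mv]; exists (n + m)%N.
have [k] := ubnP (n + m); elim: k n m u v nu mv => // k IH n m u v nu mv nm.
case: n nu nm => [/= -> _|n nu nm]; first by rewrite br0l iter_lfun0.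
case: m mv nm => [v0 _|m mv nm]; first by rewrite (v0 : v = 0) br0r iter_lfun0.
have E : (ad g x - (a + b) *: \1)%VF (bracket u v)
   = bracket ((ad g x - a *: \1)%VF u) v + bracket u ((ad g x - b *: \1)%VF v).
  rewrite !shiftE !adE brJ brDl brDr brNl brNr brZl brZr scalerDl opprD.
  by rewrite addrACA.
have nu' : iter n (ad g x - a *: \1)%VF ((ad g x - a *: \1)%VF u) = 0.
  by rewrite -iterSr.
have mv' : iter m (ad g x - b *: \1)%VF ((ad g x - b *: \1)%VF v) = 0.
  by rewrite -iterSr.
have nm' : (n + m.+1 < k)%N by rewrite -ltnS -addSn.
have nm'' : (n.+1 + m < k)%N by rewrite addSnnS.
rewrite addSn iterSr E iter_lfunD (IH _ _ _ _ nu' mv nm') -addSnnS.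
by rewrite (IH _ _ _ _ nu mv' nm'') addr0.
Qed.

(** The Leibniz rule is checked on generalized eigenvectors, whose eigenvalues add under the
    bracket. It is applied to conjugation and to the identity. *)
Lemma spectral_map_derivation x (phi : C -> C) (D : 'End(g)) :
  {morph phi : a b / a + b} ->
  (forall c v, gen_eigen (ad g x) c v -> D v = phi c *: v) -> derivation D.
Proof.
move=> phiD DE u v; have [cs [p [ucs pE _ pge]]] := gen_eigen_decomp (ad g x).
rewrite (pE u) (pE v) !lfun_sum !brsuml lfun_sum -big_split /= !big_seq.
apply: eq_bigr => c ccs; rewrite !brsumr lfun_sum -big_split /=.
apply: eq_bigr => d dcs.
rewrite (DE _ _ (gen_eigen_br (pge _ u ccs) (pge _ v dcs))).
by rewrite (DE _ _ (pge _ u ccs)) (DE _ _ (pge _ v dcs)) brZl brZr phiD scalerDl.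
Qed.

End SpectralDerivation.

(** * Cartan subalgebras of simple Lie algebras *)

(** The composite of commuting maps is nilpotent as soon as one of them is. *)
Lemma lftrace_comp_nil (C : closedFieldType) (V : vectType C) (f h : 'End(V)) :
  (f \o h = h \o f)%VF -> (forall v, gen_eigen f 0 v) -> lftrace (f \o h)%VF = 0.
Proof.
move=> fh fnil; apply: lftrace_nil => v.
have [n nv] := (gen_eigen_zero f v).1 (fnil v); exists n.
suff -> : iter n (f \o h)%VF v = iter n h (iter n f v) by rewrite nv iter_lfun0.
elim: n {nv} => //= n ->; rewrite comp_lfunE -[h (iter n h _)]iterS.
by rewrite -[RHS]iterS -iter_comm.
Qed.

Section Cartan.
Context (C : numClosedFieldType) (g : lieAlgType C) (t : {vspace g}).
Hypotheses (g_simple : simple_lie g) (t_cartan : cartan_subalgebra t).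
Implicit Types (x y z u v w s : g).

Let t_sub : lie_subalgebra t. Proof. by case: t_cartan. Qed.
Let t_nil : lie_nilpotent t. Proof. by case: t_cartan. Qed.

Lemma cartan_self_normalizing x : (forall y, y \in t -> bracket y x \in t) -> x \in t.
Proof.
case: t_cartan => _ _ H Hx; apply: H => y yt; rewrite brC memvN.
exact: Hx.
Qed.

(** Engel's theorem on [g] modulo [t]: a vector of the class outside [t] would yield one outside [t]
    that normalizes [t]. *)
Lemma engel_cartan (ys : seq g) (P : g -> Prop) :
  engel_seq ys -> <<ys>>%VS = t ->
  (forall y w, y \in ys -> P w -> P (bracket y w)) ->
  (forall y w, y \in ys -> P w -> exists n, iter n (ad g y) w \in t) ->
  forall w, P w -> w \in t.
Proof.
move=> eys yst stP nil w Pw; apply/negPn/negP => wt.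
have yt y : y \in ys -> y \in t by rewrite -yst => /memv_span.
have [||||w' [Pw' w't sw]] := @engel _ g g (ad g) ys P t (ad_rep (g := g)) eys.
- by move=> y w' ys' Pw'; rewrite adE; apply: stP.
- by move=> y w' /yt ys' wt'; rewrite adE; apply: t_sub.
- exact: nil.
- by exists w.
case/negP: w't; apply: cartan_self_normalizing; rewrite -yst.
apply: span_ind => [|a b|c a|a /sw]; rewrite ?br0l ?mem0v ?adE // yst.
- by rewrite brDl; apply: memvD.
- by rewrite brZl; apply: memvZ.
- by [].
Qed.

(* If K = 0, the conjugation device makes every ad x nilpotent; Engel's theorem on
   g / t then gives t = g, against [g, g] = g. *)
Lemma killing_nondeg x : (forall y, killing x y = 0) -> x = 0.
Proof.
have [T TE] := trform_lfun (ad g).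
have perf := simple_perfect g_simple.
(* The radical of the Killing form is an ideal, so it is zero or all of [g]; the second case has to
   be refuted. *)
have Iid : lie_ideal (lker T).
  move=> a b; rewrite !memv_ker => /eqP Tb; apply/eqP/lfunP => z.
  rewrite TE zero_lfunE brC -[- _]scaleN1r trformZl trform_inv; last exact: ad_rep.
  by rewrite -TE Tb zero_lfunE mulr0.
case: (g_simple.2 _ Iid) => [T0|Tf] xK.
  by apply/eqP; rewrite -memv0 -T0 memv_ker; apply/eqP/lfunP => y;
    rewrite TE -killingE xK zero_lfunE.
have K0 (a b : g) : killing a b = 0.
  have : a \in lker T by rewrite Tf memvf.
  by rewrite memv_ker => /eqP Ta; rewrite killingE -TE Ta zero_lfunE.
exfalso.
have nil a : forall v, gen_eigen (ad g a) 0 v.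
  have [D [DE _ D0]] := conj_nilpotent (ad g a); apply: D0.
  have dD : derivation D.
    by apply: (spectral_map_derivation _ DE) => b c; rewrite rmorphD.
  suff H z : z \in brv fullv fullv -> lftrace (ad g z \o D)%VF = 0.
    by apply: H; rewrite perf memvf.
  elim/brv_ind => {z} [|b c IHb IHc|c b IHb|b c _ _].
  - by rewrite linear0 comp_lfun0l lftrace0.
  - by rewrite lfunD comp_lfunDl lftraceD IHb IHc addr0.
  - by rewrite lfunZ -comp_lfunZl lftraceZ IHb mulr0.
  - by rewrite lftrace_ad_derivation // K0 oppr0.
have [ys eys yst] := engel_seq_exists t_sub t_nil.
have tf : t = fullv.
  apply/eqP; rewrite eqEsubv subvf; apply/subvP => w _.
  apply: (@engel_cartan ys (fun=> True)) => // y w' _ _.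
  by have [n nw] := (gen_eigen_zero _ _).1 (nil y w'); exists n; rewrite nw mem0v.
have lc n : lower_central t n = fullv.
  elim: n => // n IH; have -> : lower_central t n.+1 = brv t (lower_central t n) by [].
  by rewrite IH tf perf.
have [n] := t_nil; rewrite lc => f0; have [[a [b ab]] _] := g_simple.
case/negP: ab; rewrite -memv0 -f0 memvf //.
Qed.

Lemma center0 x : (forall y, bracket x y = 0) -> x = 0.
Proof.
move=> x0; apply: killing_nondeg => y; rewrite killingE /trform.
suff -> : ad g x = 0 by rewrite comp_lfun0l lftrace0.
by apply/lfunP => z; rewrite adE x0 zero_lfunE.
Qed.

(** The semisimple part of [ad x] is a derivation, hence some [ad s]. As [ad x] is nilpotent on [t],
    [s] centralizes [t] and therefore lies in it. *)
Lemma cartan_semisimple_part x : x \in t -> exists s,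
  [/\ s \in t, forall y, y \in t -> bracket s y = 0, semisimple_lfun (ad g s),
      forall v, bracket s v = 0 -> gen_eigen (ad g x) 0 v
    & forall v, gen_eigen (ad g (x - s)) 0 v].
Proof.
move=> xt; have [D [DE Dg Dd Dn]] := semisimple_part (ad g x).
have dD : derivation D by apply: (spectral_map_derivation _ DE).
have [s sD] := derivation_inner dD killing_nondeg; exists s.
have st y : y \in t -> bracket s y = 0.
  move=> yt; rewrite -adE sD (DE 0) ?scale0r //; apply/gen_eigen_zero.
  exact: ad_nil_subalg xt yt.
split=> //.
- by apply: cartan_self_normalizing => y yt; rewrite brC st // oppr0 mem0v.
- by rewrite sD.
- by move=> v sv; apply: Dg; rewrite scale0r -sD adE.
- by move=> v; rewrite linearB /= sD.
Qed.

(* The sequence consists of the semisimple parts of elements spanning t. *)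
Lemma cartan_frame : exists (ss : seq g),
  [/\ forall s, s \in ss -> s \in t /\ (forall y, y \in t -> bracket s y = 0)
                           /\ semisimple_lfun (ad g s)
    & forall w, (forall s, s \in ss -> bracket s w = 0) -> w \in t].
Proof.
have [ys eys yst] := engel_seq_exists t_sub t_nil.
have yt y : y \in ys -> y \in t by rewrite -yst => /memv_span.
have Hs y : exists s, y \in t ->
  [/\ s \in t, forall y, y \in t -> bracket s y = 0, semisimple_lfun (ad g s),
      forall v, bracket s v = 0 -> gen_eigen (ad g y) 0 v
    & forall v, gen_eigen (ad g (y - s)) 0 v].
  have [/cartan_semisimple_part[s sP]|_] := boolP (y \in t); first by exists s.
  by exists 0.
have [s sP] := choice Hs; exists [seq s y | y <- ys]; split.
  by move=> _ /mapP[y /yt/sP[s1 s2 s3 _ _] ->].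
(* The class is the joint centralizer of the semisimple parts: [t] preserves it because these parts
   centralize [t], and each [ad y] is nilpotent on it. *)
apply: (engel_cartan eys yst) => y w yys Pw.
  move=> _ /mapP[y' y'ys ->]; have [s1 s2 s3 _ _] := sP y' (yt y' y'ys).
  by rewrite brJ s2 ?yt // br0l add0r (Pw _ (map_f s y'ys)) br0r.
have [s1 s2 s3 s4 _] := sP y (yt y yys).
have [n nw] := (gen_eigen_zero _ _).1 (s4 w (Pw _ (map_f s yys))).
by exists n; rewrite nw mem0v.
Qed.

(** Any [v] is a sum of joint eigenvectors of the frame. Those killed by the whole frame lie in [t];
    one with nonzero eigenvalue for some [s] is orthogonal to [z] by invariance, as [s] commutes
    with [z]. *)
Lemma killing_cartan_nondeg z : z \in t ->
  (forall y, y \in t -> killing z y = 0) -> z = 0.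
Proof.
move=> zt z0; apply: killing_nondeg => v; have [ss [ssP ssC]] := cartan_frame.
have [||ws -> wsP] := @joint_eigen _ _ [seq ad g s | s <- ss] _ _ v.
- by move=> _ /mapP[s /ssP[_ [_ ds]] ->].
- move=> _ _ /mapP[s /ssP[st [sc _]] ->] /mapP[s' /ssP[st' _] ->].
  apply/eqP; rewrite -subr_eq0 -repE ?sc //; last exact: ad_rep.
  by rewrite linear0.
have [T TE] := trform_lfun (ad g).
rewrite killingE -TE lfun_sum big_seq big1 // => w wws.
rewrite TE -killingE.
have [P|P] := pselect (forall s, s \in ss -> bracket s w = 0); first exact/z0/ssC.
have [s sss [c [c0 sw]]] :
    exists2 s, s \in ss & exists c, c != 0 /\ bracket s w = c *: w.
  apply: contrapT => H; apply: P => s sss.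
  have [|c] := wsP w (ad g s) wws; first exact: map_f.
  rewrite adE => sw; have [c0|c0] := eqVneq c 0; first by rewrite sw c0 scale0r.
  by case: H; exists s => //; exists c.
have [_ [sc _]] := ssP s sss.
apply/eqP; rewrite -(mulrI_eq0 _ (mulfI c0)) killingE -trformZr -sw -killingE.
rewrite -killing_inv brC sc // oppr0 killingE /trform linear0 comp_lfun0l.
by rewrite lftrace0.
Qed.

Lemma central_nil z : z \in t -> (forall y, y \in t -> bracket z y = 0) ->
  (forall v, gen_eigen (ad g z) 0 v) -> z = 0.
Proof.
move=> zt zc zn; apply: killing_cartan_nondeg => // y yt.
apply: lftrace_comp_nil => //; apply/eqP; rewrite -subr_eq0 -repE; last exact: ad_rep.
by rewrite zc // linear0.
Qed.

(* The last nonzero term of the lower central series of t would be central and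
   consist of brackets, hence ad-nilpotent by the conjugation device. *)
Lemma cartan_abelian x y : x \in t -> y \in t -> bracket x y = 0.
Proof.
have H k : lower_central t k.+2 = 0%VS -> lower_central t k.+1 = 0%VS.
  move=> k2; have [s1 s2] := lower_central_sub k t_sub.
  apply/eqP; rewrite -subv0; apply/subvP => z zk.
  have zt : z \in t by apply: (subvP s2); apply: (subvP s1).
  have zc y' : y' \in t -> bracket z y' = 0.
    move=> yt; apply/eqP; rewrite -memv0 -k2 brC memvN; exact: mem_brv.
  rewrite memv0; apply/eqP/central_nil => //.
  have [D [DE Dc D0]] := conj_nilpotent (ad g z); apply: D0.
  suff H' z' : z' \in lower_central t k.+1 -> lftrace (ad g z' \o D)%VF = 0.
    exact: H'.
  elim/brv_ind => {z'} [|b c IHb IHc|c b IHb|b c bt ct].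
  - by rewrite linear0 comp_lfun0l lftrace0.
  - by rewrite lfunD comp_lfunDl lftraceD IHb IHc addr0.
  - by rewrite lfunZ -comp_lfunZl lftraceZ IHb mulr0.
  (* As [z] is central in [t], its conjugate map commutes with [ad a] for [a] in [t], and cyclicity
     of the trace disposes of brackets. *)
  - have Dcom a : a \in t -> (D \o ad g a = ad g a \o D)%VF.
      move=> at_; apply: Dc; apply/eqP; rewrite -subr_eq0 -repE; last exact: ad_rep.
      by rewrite zc // linear0.
    rewrite repE; last exact: ad_rep.
    rewrite comp_lfunDl comp_lfunNl lftraceB -comp_lfunA -Dcom; last exact: (subvP s2).
    by rewrite comp_lfunA lftraceC comp_lfunA subrr.
have [m tm] := t_nil.
have t1 : lower_central t 1 = 0%VS.
  case: m tm => [t0|m]; last by elim: m => // m IH /H.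
  apply/eqP; rewrite -subv0; apply/subvP => z.
  have [s1 _] := lower_central_sub 0 t_sub.
  by move/(subvP s1); rewrite t0.
by move=> xt yt; apply/eqP; rewrite -memv0 -t1; apply: mem_brv.
Qed.

(** The difference between [x] and its semisimple part is central in [t] and ad-nilpotent, hence
    zero. *)
Lemma cartan_toral x : x \in t -> semisimple_lfun (ad g x).
Proof.
move=> xt; have [s [st sc sd _ xs]] := cartan_semisimple_part xt.
suff -> : x = s by [].
apply/eqP; rewrite -subr_eq0; apply/eqP/central_nil => //; first exact: memvB.
by move=> y yt; apply: cartan_abelian => //; exact: memvB.
Qed.

Lemma cartan_centralizer x : (forall y, y \in t -> bracket y x = 0) -> x \in t.
Proof. by move=> xc; apply: cartan_self_normalizing => y /xc ->; apply: mem0v. Qed.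

End Cartan.

(** * Weights and roots *)

Lemma free_subseq (F : fieldType) (V : vectType F) (X : seq V) :
  exists Y, [/\ {subset Y <= X}, free Y & <<Y>>%VS = <<X>>%VS].
Proof.
elim: X => [|x X [Y [YX fY YE]]]; first by exists [::]; rewrite nil_free.
have [xY|xY] := boolP (x \in <<Y>>%VS).
  exists Y; split=> //; first by move=> y /YX; rewrite inE orbC => ->.
  rewrite span_cons -YE; apply/esym/addv_idPr; rewrite -memvE //.
exists (x :: Y); split; rewrite ?free_cons ?xY // ?span_cons ?YE //.
by move=> y; rewrite !inE => /orP[->//|/YX ->]; rewrite orbT.
Qed.

Lemma functional_one (F : fieldType) (V : vectType F) (v : V) : v != 0 ->
  exists l : 'Hom(V, F^o), l v = 1.
Proof.
move=> v0; have [|l lE] := @lfun_exists _ V F^o (coord [tuple v] ord0).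
  by move=> c x y; rewrite linearP.
exists l; rewrite lE -[X in coord _ _ X]/([tuple v]`_(ord0 : 'I_1)).
by rewrite coord_free ?eqxx // seq1_free.
Qed.

Lemma lftrace_diag (F : fieldType) (V : vectType F) n (e : n.-tuple V)
    (f : 'End(V)) (c : 'I_n -> F) : basis_of {:V} e ->
  (forall i : 'I_n, f e`_i = c i *: e`_i) -> lftrace f = \sum_i c i.
Proof.
move=> be fe; rewrite (lftrace_basis _ be); apply: eq_bigr => i _.
by rewrite fe linearZ /= coord_free ?(basis_free be) // eqxx mulr1.
Qed.

Section Weights.
Context (F : fieldType) (g : lieAlgType F) (t : {vspace g}).
Context (V : vectType F) (rho : 'Hom(g, 'End(V))).
Implicit Types (mu alpha : dual t) (v w : V) (h : subvs_of t).

Lemma joint_eigen_weight w :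
  (forall x, x \in vbasis t -> exists c, rho x w = c *: w) ->
  exists mu : dual t, w \in weight_space rho mu.
Proof.
move=> H; have [->|w0] := eqVneq w 0; first by exists 0; apply: mem0v.
have Ht x : x \in t -> exists c, rho x w = c *: w.
  move=> xt; have : x \in <<vbasis t>>%VS by rewrite (span_basis (vbasisP t)).
  move: x {xt}; apply: span_ind => [|x y [a xa] [b yb]|c x [a xa]|]; last exact: H.
  - by exists 0; rewrite linear0 zero_lfunE scale0r.
  - by exists (a + b); rewrite lfunD add_lfunE xa yb scalerDl.
  - by exists (c * a); rewrite lfunZ scale_lfunE xa scalerA.
(* A functional with value 1 at [w] extracts the eigenvalue of [h], which is thereby linear in
   [h]. *)
have [l lw] := functional_one w0.
have [|mu muE] := @lfun_exists _ (subvs_of t) F^o (fun h => l (rho (vsval h) w)).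
  move=> c x y.
  have -> : vsval (c *: x + y) = c *: vsval x + vsval y by exact: (linearP vsval).
  by rewrite lfunD lfunZ add_lfunE scale_lfunE lfunD lfunZ.
exists mu; apply/weight_spaceP => h; rewrite muE.
by have [c ->] := Ht _ (subvsP h); rewrite lfunZ lw [_ *: 1]mulr1.
Qed.

Definition weighted n (e : n.-tuple V) (wt : V -> dual t) :=
  basis_of {:V} e /\ forall v, v \in e -> v \in weight_space rho (wt v).

Definition weight_spanned :=
  forall v, exists2 ws : seq V, v = \sum_(w <- ws) w &
    forall w, w \in ws -> exists mu : dual t, w \in weight_space rho mu.

(** The vectors of a basis are split into weight vectors, and a basis is extracted from these. *)
Lemma weighted_exists : weight_spanned ->
  exists (e : (\dim {:V}).-tuple V) wt, weighted e wt.
Proof.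
move=> H.
have [X Xw XE] : exists2 X : seq V,
    (forall w, w \in X -> exists mu : dual t, w \in weight_space rho mu)
    & <<X>>%VS = fullv.
  suff HB (B : seq V) : exists2 X : seq V,
    (forall w, w \in X -> exists mu : dual t, w \in weight_space rho mu)
    & {subset B <= <<X>>%VS}.
    have [X Xw XE] := HB (vbasis {:V}); exists X => //.
    apply/eqP; rewrite eqEsubv subvf.
    by rewrite -[fullv](span_basis (vbasisP _)); apply/span_subvP.
  elim: B => [|v B [X Xw XE]]; first by exists [::].
  have [ws vws wsP] := H v; exists (ws ++ X).
    by move=> w; rewrite mem_cat => /orP[/wsP|/Xw].
  move=> b; rewrite inE span_cat => /orP[/eqP ->|/XE bX].
    apply: (subvP (addvSl _ _)); rewrite vws big_seq memv_suml // => w.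
    exact: memv_span.
  exact: (subvP (addvSr _ _)).
have [Y [YX fY YE]] := free_subseq X.
have bY : basis_of {:V} Y by rewrite /basis_of fY YE XE eqxx.
have sY : size Y == \dim {:V}.
  by move: fY; rewrite /free YE XE eq_sym.
have Hwt w : exists mu : dual t, w \in Y -> w \in weight_space rho mu.
  have [/YX/Xw[mu wmu]|_] := boolP (w \in Y); first by exists mu.
  by exists 0.
have [wt wtP] := choice Hwt.
by exists (Tuple sY), wt; split.
Qed.

Section WeightedBasis.
Context n (e : n.-tuple V) (wt : V -> dual t) (ewt : weighted e wt).

Let be : basis_of {:V} e. Proof. by case: ewt. Qed.

Lemma weighted_eigen (i : 'I_n) h :
  rho (vsval h) e`_i = (wt e`_i h : F) *: e`_i.
Proof.
have /ewt.2/weight_spaceP : e`_i \in e by rewrite mem_nth ?size_tuple.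
exact.
Qed.

Lemma weighted_trace h : lftrace (rho (vsval h)) = \sum_(i < n) (wt e`_i h : F).
Proof. by rewrite (lftrace_diag be (fun i => weighted_eigen i h)). Qed.

Lemma weighted_coord mu v (i : 'I_n) : v \in weight_space rho mu ->
  coord e i v != 0 -> wt e`_i = mu.
Proof.
move=> /weight_spaceP vmu ci; apply/lfunP => h.
have := congr1 (coord e i) (vmu h).
rewrite {1}(coord_basis be (memvf v)) lfun_sum linearZ /=.
have -> : \sum_j rho (vsval h) (coord e j v *: e`_j) =
   \sum_j (coord e j v * (wt e`_j h : F)) *: e`_j.
  by apply: eq_bigr => j _; rewrite lfunZ weighted_eigen scalerA.
rewrite coord_sum_free ?(basis_free be) // mulrC.
exact: (mulIf ci).
Qed.

Lemma weighted_space mu :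
  weight_space rho mu = <<[seq v <- e | wt v == mu]>>%VS.
Proof.
apply/eqP; rewrite eqEsubv; apply/andP; split; last first.
  by apply/span_subvP => v; rewrite mem_filter => /andP[/eqP <- /ewt.2].
apply/subvP => v vmu; rewrite (coord_basis be (memvf v)); apply: memv_suml => i _.
have [->|ci] := eqVneq (coord e i v) 0; first by rewrite scale0r mem0v.
apply/memvZ/memv_span; rewrite mem_filter (weighted_coord vmu ci) eqxx.
by rewrite mem_nth ?size_tuple.
Qed.

Lemma weighted_mult mu : weight_mult rho mu = count (fun v => wt v == mu) e.
Proof.
rewrite /weight_mult weighted_space -size_filter.
by apply/eqP; apply: (filter_free _ (basis_free be)).
Qed.

Lemma weighted_weights v : v \in e -> weights rho (wt v).
Proof.
move=> ve; apply: contraTneq isT => w0; have := ewt.2 _ ve; rewrite w0 memv0.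
by rewrite (negPf (basis_not0 be ve)).
Qed.

(** Regroups a weight basis by weight, so that sums with multiplicities, in particular power sums,
    become traces. *)
Lemma weighted_sum_mult (f : dual t -> F) :
  \sum_(mu \in weights rho) (weight_mult rho mu)%:R * f mu
    = \sum_(v <- e) f (wt v).
Proof.
have fw := @finite_weights _ g t V rho.
rewrite fsbig_finite //=.
under eq_bigr => mu _.
  rewrite weighted_mult -sum1_count natr_sum big_distrl /=.
  under eq_bigr do rewrite mul1r.
  rewrite big_mkcond /=.
  over.
rewrite exchange_big /= !big_seq; apply: eq_bigr => v ve.
rewrite (bigD1_seq (wt v)) ?finmap.fset_uniq //=; last first.
  by rewrite in_fset_set // inE; apply: weighted_weights.
by rewrite eqxx big1 ?addr0 // => mu; rewrite eq_sym => /negPf ->.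
Qed.

Lemma weighted_power_sum k h : power_sum k rho h = \sum_(i < n) (wt e`_i h : F) ^+ k.
Proof.
rewrite /power_sum (weighted_sum_mult (fun mu => (mu h : F) ^+ k)).
by rewrite (big_nth 0) size_tuple big_mkord.
Qed.

Lemma power_sum0 h : power_sum 0 rho h = (\dim {:V})%:R.
Proof.
rewrite weighted_power_sum; under eq_bigr do rewrite expr0.
by rewrite sumr_const card_ord (size_basis be).
Qed.

Lemma power_sum1 h : power_sum 1 rho h = lftrace (rho (vsval h)).
Proof.
rewrite weighted_power_sum weighted_trace.
by apply: eq_bigr => i _; rewrite expr1.
Qed.

Lemma power_sum2 h : power_sum 2 rho h = trform rho (vsval h) (vsval h).
Proof.
rewrite weighted_power_sum /trform.
rewrite (lftrace_diag (c := fun i => (wt e`_i h : F) ^+ 2) be) // => i.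
by rewrite comp_lfunE weighted_eigen lfunZ weighted_eigen scalerA.
Qed.

End WeightedBasis.

Lemma weight_spaceD alpha mu x v : representation rho ->
  x \in weight_space (ad g) alpha -> v \in weight_space rho mu ->
  rho x v \in weight_space rho (alpha + mu).
Proof.
move=> rr /weight_spaceP xa /weight_spaceP vm; apply/weight_spaceP => h.
have -> : rho (vsval h) (rho x v)
   = rho (bracket (vsval h) x) v + rho x (rho (vsval h) v).
  by rewrite rr subrK.
by rewrite -adE xa vm !lfunZ scale_lfunE -scalerDl add_lfunE.
Qed.

End Weights.

(* The eigenvalues c - k a of Z along the string Y^k v are pairwise distinct,
   so the string stops, at a place where the factor c - k a / 2 vanishes. *)
Lemma sl2_highest_integral (F : numFieldType) (V : vectType F) (X Y Z : 'End(V))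
    (a c : F) (v : V) :
  (forall w, X (Y w) = Y (X w) + Z w) ->
  (forall w, Z (Y w) = Y (Z w) - a *: Y w) ->
  a != 0 -> v != 0 -> X v = 0 -> Z v = c *: v -> exists n, 2 * c / a = n%:R.
Proof.
move=> XY ZY a0 v0 Xv Zv.
have Zk k : Z (iter k Y v) = (c - k%:R * a) *: iter k Y v.
  elim: k => [|k IH]; first by rewrite mul0r subr0.
  rewrite iterS ZY IH lfunZ -scalerBl; congr (_ *: _).
  by rewrite -natr1 mulrDl mul1r opprD addrA.
have Xk k : X (iter k.+1 Y v) = (k.+1%:R * (c - k%:R * a / 2)) *: iter k Y v.
  elim: k => [|k IH]; first by rewrite /= XY Xv linear0 add0r Zv !mul0r subr0 mul1r.
  rewrite iterS XY IH lfunZ -iterS Zk -scalerDl; congr (_ *: _).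
  rewrite -!natr1; by field.
have [k [kY kY1]] : exists k, iter k Y v != 0 /\ iter k.+1 Y v = 0.
  apply: contrapT => H.
  have Y0 k : iter k Y v != 0.
    elim: k => // k IH; apply/eqP => H1; apply: H; by exists k.
  have inj : injective (fun k : nat => c - k%:R * a).
    move=> i j /addrI/oppr_inj/(mulIf a0)/eqP; by rewrite eqr_nat => /eqP.
  have : finite_set [set: nat].
    have := finite_preimage (f := fun k : nat => c - k%:R * a)
      (in2W inj) (finite_leigenvalues Z).
    apply: sub_finite_set => k _ /=.
    apply: contraNneq (Y0 k) => Z0.
    have : iter k Y v \in leigenspace Z (c - k%:R * a).
      by rewrite memv_ker add_lfunE opp_lfunE scale_lfunE id_lfunE Zk subrr.
    by rewrite Z0 memv0.
  exact: infinite_nat.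
exists k; have := Xk k; rewrite kY1 linear0 => /esym/eqP.
rewrite scaler_eq0 (negPf kY) orbF mulf_eq0 pnatr_eq0 /= subr_eq0 => /eqP ->.
by field.
Qed.

(** * Root spaces and integrality *)

Section Roots.
Context (C : numClosedFieldType) (g : lieAlgType C) (t : {vspace g}).
Hypotheses (g_simple : simple_lie g) (t_cartan : cartan_subalgebra t).
Implicit Types (x y z : g) (mu alpha beta : dual t) (h : subvs_of t).

Lemma ad_weight_spanned : weight_spanned t (ad g).
Proof.
move=> v; have [||ws vws wsP] := @joint_eigen _ _ [seq ad g x | x <- vbasis t] _ _ v.
- move=> _ /mapP[x /vbasis_mem xt ->]; exact: (cartan_toral g_simple t_cartan).
- move=> _ _ /mapP[x /vbasis_mem xt ->] /mapP[y /vbasis_mem yt ->].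
  apply/eqP; rewrite -subr_eq0 -repE; last exact: ad_rep.
  by rewrite (cartan_abelian g_simple t_cartan) // linear0.
exists ws => // w wws; apply: joint_eigen_weight => x xt.
by apply: wsP => //; apply: map_f.
Qed.

Lemma weight_space0 : weight_space (ad g) (0 : dual t) = t.
Proof.
apply/vspaceP => x; apply/weight_spaceP/idP => [x0|xt h].
  apply: (cartan_centralizer t_cartan) => y yt.
  by have := x0 (vsproj t y); rewrite vsprojK // adE zero_lfunE scale0r.
by rewrite adE zero_lfunE scale0r (cartan_abelian g_simple t_cartan) ?subvsP.
Qed.

(** Invariance under [h] gives (alpha + beta)(h) K(x, y) = 0, and some [h] has a nonzero factor. *)
Lemma killing_weight_orth alpha beta x y : x \in weight_space (ad g) alpha ->
  y \in weight_space (ad g) beta -> alpha + beta != 0 -> killing x y = 0.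
Proof.
move=> /weight_spaceP xa /weight_spaceP yb /lfunPn[h].
rewrite add_lfunE zero_lfunE => ab.
apply/eqP; rewrite -(mulrI_eq0 _ (mulfI ab)) mulrDl.
rewrite killingE -{1}trformZl -trformZr -xa -yb !adE.
by rewrite brC -[- _]scaleN1r trformZl trform_inv ?mulN1r ?addNr //; apply: ad_rep.
Qed.

(** Nondegeneracy pairs [x] nontrivially with some weight vector, and orthogonality forces the
    weight of that vector to be [- alpha]. *)
Lemma killing_dual_exists x alpha : x \in weight_space (ad g) alpha -> x != 0 ->
  exists2 y, y \in weight_space (ad g) (- alpha) & killing x y = 1.
Proof.
move=> xa x0; apply: contrapT => H.
case/eqP: x0; apply: (killing_nondeg g_simple t_cartan) => v.
have [ws -> wsP] := ad_weight_spanned v.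
have [T TE] := trform_lfun (ad g).
rewrite killingE -TE lfun_sum big_seq big1 // => w /wsP[mu wmu].
rewrite TE -killingE; have [amu|] := eqVneq (alpha + mu) 0; last first.
  exact: killing_weight_orth.
apply: contrapT => /eqP K0; apply: H; exists ((killing x w)^-1 *: w).
  by apply: memvZ; rewrite -(addKr alpha mu) amu addr0 in wmu.
by rewrite killingE trformZr -killingE mulVf.
Qed.

Lemma rootN alpha : Defs.roots alpha -> Defs.roots (- alpha).
Proof.
move=> [a0 wa]; split; first by rewrite oppr_eq0.
have : vpick (weight_space (ad g) alpha) != 0 by rewrite vpick0.
move=> /(killing_dual_exists (memv_pick _))[y ya xy].
apply: contraTneq isT => E0; move: xy; move: ya; rewrite E0 memv0 => /eqP ->.
rewrite killingE /trform linear0 comp_lfun0r lftrace0 => /eqP.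
by rewrite eq_sym oner_eq0.
Qed.

(** The element t_mu of [t] that represents [mu] under the Killing form, without the factor 2 / (mu,
    mu) of the usual coroot. *)
Definition coroot mu : g := vsval ((killing_iso t)^-1%VF mu).

Lemma coroot_mem mu : coroot mu \in t.
Proof. exact: subvsP. Qed.

Lemma killing_iso_inv mu : killing_iso t ((killing_iso t)^-1%VF mu) = mu.
Proof.
apply: limg_lfunVK.
have [|h <-] := form_represent (T := killing_iso t) _ mu;
  last exact: memv_img (memvf h).
move=> h h0; apply: val_inj; apply: (killing_cartan_nondeg g_simple t_cartan).
  exact: subvsP.
by move=> y yt; have := h0 (vsproj t y); rewrite killing_isoE vsprojK.
Qed.

Lemma killing_coroot mu h : killing (coroot mu) (vsval h) = mu h.
Proof. by rewrite -killing_isoE killing_iso_inv. Qed.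

Lemma killing_dualE mu alpha :
  killing_dual mu alpha = mu (vsproj t (coroot alpha)).
Proof. by rewrite -killing_coroot vsprojK ?coroot_mem. Qed.

Lemma coroot_eigen alpha mu (V : vectType C) (rho : 'Hom(g, 'End(V))) v :
  v \in weight_space rho mu ->
  rho (coroot alpha) v = killing_dual mu alpha *: v.
Proof.
move=> /weight_spaceP vm; rewrite killing_dualE.
by have := vm (vsproj t (coroot alpha)); rewrite vsprojK ?coroot_mem.
Qed.

(** Both sides lie in [t] and, by invariance, pair equally with all of [t]. *)
Lemma root_bracket alpha x y : x \in weight_space (ad g) alpha ->
  y \in weight_space (ad g) (- alpha) ->
  bracket x y = killing x y *: coroot alpha.
Proof.
move=> xa ya.
have xyt : bracket x y \in t.
  rewrite -weight_space0 -(subrr alpha) -adE; apply: weight_spaceD => //.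
  exact: ad_rep.
apply/eqP; rewrite -subr_eq0; apply/eqP.
apply: (killing_cartan_nondeg g_simple t_cartan).
  by rewrite memvB ?memvZ ?coroot_mem.
move=> y' y't; rewrite killingE -scaleN1r trformDl trformZl trformZl mulN1r -!killingE.
have -> : y' = vsval (vsproj t y') by rewrite vsprojK.
rewrite killing_coroot killingC killingE -trform_inv; last exact: ad_rep.
have /weight_spaceP/(_ (vsproj t y')) := xa; rewrite adE => ->.
by rewrite trformZl -killingE mulrC subrr.
Qed.

(** Otherwise t_alpha = [x, y] commutes with [y], so the conjugate of [ad] t_alpha commutes with
    [ad y] and its trace against [ad] t_alpha vanishes. Then [ad] t_alpha is nilpotent and
    semisimple, and t_alpha is central, hence zero. *)
Lemma killing_dual_root alpha : Defs.roots alpha -> killing_dual alpha alpha != 0.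
Proof.
move=> [a0 wa]; apply/eqP => aa.
have : vpick (weight_space (ad g) alpha) != 0 by rewrite vpick0.
set x := vpick _; have xa : x \in weight_space (ad g) alpha by apply: memv_pick.
move=> /(killing_dual_exists xa)[y ya xy].
have xyE := root_bracket xa ya; rewrite xy scale1r in xyE.
have zx : bracket (coroot alpha) x = 0 by rewrite -adE (coroot_eigen _ xa) aa scale0r.
have zy : bracket (coroot alpha) y = 0.
  rewrite -adE (coroot_eigen _ ya) killing_dualE opp_lfunE -killing_dualE aa.
  by rewrite oppr0 scale0r.
have com z : bracket (coroot alpha) z = 0 ->
    (ad g (coroot alpha) \o ad g z = ad g z \o ad g (coroot alpha))%VF.
  move=> cz; apply/eqP; rewrite -subr_eq0 -repE; last exact: ad_rep.
  by rewrite cz linear0.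
have [D [_ Dc D0]] := conj_nilpotent (ad g (coroot alpha)).
have z0 : coroot alpha = 0.
  apply: (center0 g_simple t_cartan) => v; rewrite -adE.
  rewrite (cartan_toral g_simple t_cartan (coroot_mem alpha) (c := 0)) ?scale0r //.
  apply: D0; rewrite -xyE (repE _ _ (ad_rep (g := g))) comp_lfunDl comp_lfunNl lftraceB.
  rewrite -comp_lfunA -(Dc _ (com _ zy)) comp_lfunA lftraceC.
  by rewrite -[X in _ - lftrace X]comp_lfunA subrr.
case/eqP: a0; apply/lfunP => h; rewrite zero_lfunE -killing_coroot z0.
by rewrite killingE /trform linear0 comp_lfun0l lftrace0.
Qed.

Lemma root_highest_integral alpha (V : vectType C) (rho : 'Hom(g, 'End(V))) mu x y v :
  representation rho -> Defs.roots alpha -> x \in weight_space (ad g) alpha ->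
  y \in weight_space (ad g) (- alpha) -> killing x y = 1 ->
  v \in weight_space rho mu -> v != 0 -> rho x v = 0 ->
  exists n, 2 * killing_dual mu alpha / killing_dual alpha alpha = n%:R.
Proof.
move=> rr ra xa ya xy vm v0 xv.
have xyE := root_bracket xa ya; rewrite xy scale1r in xyE.
apply: (sl2_highest_integral (X := rho x) (Y := rho y)
  (Z := rho (coroot alpha)) _ _ _ v0) => //.
- by move=> w; rewrite -xyE rr addrC subrK.
- move=> w; have := rr (coroot alpha) y w.
  rewrite -adE (coroot_eigen _ ya) killing_dualE opp_lfunE -killing_dualE.
  rewrite lfunZ scale_lfunE scaleNr => E.
  by rewrite E addrC subrK.
- exact: killing_dual_root.
- exact: coroot_eigen.
Qed.

(* A vector of g_alpha orthogonal to x in g_(- alpha) is killed by ad x, so it would be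
   a highest weight vector of coroot eigenvalue -2 for the sl2 of - alpha. *)
Lemma root_mult alpha : Defs.roots alpha -> weight_mult (ad g) alpha = 1%N.
Proof.
move=> ra; have ra' := rootN ra.
have : vpick (weight_space (ad g) (- alpha)) != 0 by rewrite vpick0; case: ra'.
set x := vpick _; have xa : x \in weight_space (ad g) (- alpha) by apply: memv_pick.
move=> x0; have [y ya xy] := killing_dual_exists xa x0.
have y0 : y != 0.
  apply: contraTneq isT => y0; move: xy; rewrite y0 killingE /trform linear0.
  by rewrite comp_lfun0r lftrace0 => /eqP; rewrite eq_sym oner_eq0.
suff E : weight_space (ad g) alpha = <[y]>%VS by rewrite /weight_mult E dim_vline y0.
apply/eqP; rewrite eqEsubv -memvE -{2}[alpha]opprK ya andbT.
apply/subvP => w wa; apply/vlineP; exists (killing x w).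
apply/eqP; rewrite -subr_eq0; apply: contrapT => /negP w0.
set w' := w - killing x w *: y in w0.
have w'a : w' \in weight_space (ad g) (- - alpha).
  by rewrite opprK memvB // memvZ // -[alpha]opprK.
have xw' : killing x w' = 0.
  rewrite killingE /w' -scaleN1r trformDr !trformZr -!killingE xy.
  by rewrite mulr1 mulN1r subrr.
have xw0 : ad g x w' = 0 by rewrite adE (root_bracket xa w'a) xw' scale0r.
have [n] := root_highest_integral (ad_rep (g := g)) ra' xa ya xy w'a w0 xw0.
have kd : killing_dual (- - alpha) (- alpha) = - killing_dual (- alpha) (- alpha).
  by rewrite killing_dualE opp_lfunE -killing_dualE.
rewrite kd mulrN mulNr mulfK ?killing_dual_root // => /eqP.
rewrite eq_sym -subr_eq0 opprK -[2]/(2%:R) -natrD pnatr_eq0.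
by rewrite addn_eq0 andbF.
Qed.

End Roots.

(** * Highest weights of finite-dimensional representations *)

Lemma lfun2_exists (F : fieldType) (U V W : vectType F) (f : U -> V -> W) :
  (forall u, linear (f u)) -> (forall v, linear (f^~ v)) ->
  exists h : 'Hom(U, 'Hom(V, W)), forall u v, h u v = f u v.
Proof.
move=> lr ll; have H u := lfun_exists (lr u).
have [|h hE] := @lfun_exists _ U _ (fun u => sval (cid (H u))).
  move=> c x y; apply/lfunP => z; rewrite add_lfunE scale_lfunE.
  by do 3 case: cid => /= ? ->; rewrite ll.
by exists h => u v; rewrite hE; case: cid.
Qed.

Section HighestWeight.
Context (F : fieldType) (g : lieAlgType F) (t : {vspace g}) (Pos : set (dual t)).
Implicit Types (x y z : g) (mu alpha lambda : dual t) (h : subvs_of t).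

Definition highest_weight_of lambda :=
  exists (V : vectType F) (rho : 'Hom(g, 'End(V))),
    representation rho /\ highest_weight Pos rho lambda.

Lemma highest_weight0 : highest_weight_of 0.
Proof.
exists F^o, 0; split; first by move=> x y v; rewrite !zero_lfunE subrr.
exists (1 : F^o); split; first exact: oner_neq0.
  by apply/weight_spaceP => h; rewrite !zero_lfunE scale0r.
by move=> *; rewrite !zero_lfunE.
Qed.

(* The tensor product of V and W is modelled by 'Hom('Hom(W, F), V). *)
Lemma highest_weightD lambda mu :
  highest_weight_of lambda -> highest_weight_of mu ->
  highest_weight_of (lambda + mu).
Proof.
move=> [V [rho [rr [v [v0 vl vP]]]]] [W [sig [ss [w [w0 wm wP]]]]].
have [||pre preE] := @lfun2_exists _ g 'Hom(W, F^o) 'Hom(W, F^o)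
   (fun x xi => (xi \o sig x)%VF).
- by move=> x c a b; rewrite comp_lfunDl -comp_lfunZl.
- by move=> xi c x y; rewrite lfunD lfunZ comp_lfunDr -comp_lfunZr.
have [||S SE] := @lfun2_exists _ g 'Hom('Hom(W, F^o), V) 'Hom('Hom(W, F^o), V)
   (fun x T => (rho x \o T)%VF + (T \o pre x)%VF).
- move=> x c a b; rewrite comp_lfunDl comp_lfunDr -comp_lfunZl -comp_lfunZr.
  by rewrite addrACA scalerDr.
- move=> T c x y; rewrite !lfunD !lfunZ comp_lfunDl comp_lfunDr.
  by rewrite -comp_lfunZl -comp_lfunZr addrACA scalerDr.
(* The rank one map [xi] to [xi w *: v] stands for the tensor product of [v] and [w]. *)
have [|u uE] := @lfun_exists _ 'Hom(W, F^o) V (fun xi => (xi w : F) *: v).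
  by move=> c a b; rewrite add_lfunE scale_lfunE scalerDl -scalerA.
have Su x xi : S x u xi = (xi w : F) *: rho x v + (xi (sig x w) : F) *: v.
  by rewrite SE add_lfunE !comp_lfunE !uE preE comp_lfunE lfunZ.
exists 'Hom('Hom(W, F^o), V), S; split.
  move=> x y T; apply/lfunP => xi.
  (* The mixed terms, grouped second, are symmetric in [x'] and [y'] and cancel in the
     commutator. *)
  have SSE x' y' : S x' (S y' T) xi = (rho x' (rho y' (T xi)) + T (pre y' (pre x' xi)))
      + (rho x' (T (pre y' xi)) + rho y' (T (pre x' xi))).
    rewrite !SE !(add_lfunE, comp_lfunE) lfunD.
    by rewrite [X in _ + X]addrC addrACA.
  rewrite add_lfunE opp_lfunE !SSE SE add_lfunE !comp_lfunE rr.
  have -> : pre (bracket x y) xi = pre y (pre x xi) - pre x (pre y xi).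
    by rewrite !preE (repE _ _ ss) comp_lfunDr comp_lfunNr !comp_lfunA.
  by rewrite lfunB addrACA -opprD [rho y (T _) + _]addrC
    [X in _ = _ - X]addrC [RHS]addrKA.
exists u; split.
- have [l lw] := functional_one w0; apply/eqP => u0.
  by have := uE l; rewrite u0 zero_lfunE lw scale1r => /esym/eqP; apply/negP.
- move: vl wm => /weight_spaceP vl /weight_spaceP wm.
  apply/weight_spaceP => h; apply/lfunP => xi.
  rewrite Su vl wm lfunZ scale_lfunE uE add_lfunE scalerDl !scalerA.
  by rewrite [(xi w : F) * _]mulrC.
- move=> alpha Pa x xa; apply/lfunP => xi.
  by rewrite Su (vP _ Pa) // (wP _ Pa) // scaler0 linear0 scale0r addr0 zero_lfunE.
Qed.

Lemma sub_representation (V V' : vectType F) (rho : 'Hom(g, 'End(V)))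
    (rho' : 'Hom(g, 'End(V'))) (i : 'Hom(V', V)) :
  injective i -> (forall x v, i (rho' x v) = rho x (i v)) ->
  representation rho -> representation rho'.
Proof. by move=> inj iE rr x y v; apply: inj; rewrite lfunB !iE rr. Qed.

Lemma quotient_representation (V V' : vectType F) (rho : 'Hom(g, 'End(V)))
    (rho' : 'Hom(g, 'End(V'))) (q : 'Hom(V, V')) :
  (forall v', exists v, q v = v') -> (forall x v, q (rho x v) = rho' x (q v)) ->
  representation rho -> representation rho'.
Proof.
move=> surj qE rr x y v'; have [v <-] := surj v'.
by rewrite -!qE rr lfunB.
Qed.

Lemma linear_vsproj_comp (V : vectType F) (U : {vspace V}) (p : 'End(V)) :
  linear (fun v : subvs_of U => vsproj U (p (vsval v))).
Proof.
move=> c a b; have -> : vsval (c *: a + b) = c *: vsval a + vsval b.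
  exact: (linearP vsval).
by rewrite lfunD lfunZ linearP.
Qed.

(** Serves twice: with the identity on an invariant [U] it is the restriction, and with the
    projection onto a complement of an invariant subspace it is the quotient. *)
Lemma compression (V : vectType F) (rho : 'Hom(g, 'End(V))) (U : {vspace V})
    (p : 'End(V)) : exists rho' : 'Hom(g, 'End(subvs_of U)),
  forall x v, rho' x v = vsproj U (p (rho x (vsval v))).
Proof.
apply: lfun2_exists => [x|v].
  move=> c a b; have := linear_vsproj_comp (U := U) (p \o rho x)%VF c a b.
  by rewrite /= !comp_lfunE.
by move=> c x y; rewrite lfunD lfunZ add_lfunE scale_lfunE lfunD lfunZ linearP.
Qed.

(** Induction on the dimension: given a proper nonzero invariant [W], the highest weight vector
    survives in [W] if it lies there, and in the quotient by [W] if not. *)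
Lemma highest_weight_irreducible lambda : highest_weight_of lambda ->
  exists (V : vectType F) (rho : 'Hom(g, 'End(V))),
    [/\ representation rho, irreducible_rep rho & highest_weight Pos rho lambda].
Proof.
move=> [V [rho [rr hw]]]; have [n] := ubnP (\dim {:V}).
elim: n V rho rr hw => // n IH V rho rr hw; rewrite ltnS => dV.
have [irr|nirr] := pselect (irreducible_rep rho); first by exists V, rho.
have [v [v0 vl vP]] := hw.
have [W [Wst W0 Wf]] : exists W : {vspace V},
    [/\ forall x, (rho x @: W <= W)%VS, W != 0%VS & W != fullv].
  apply: contrapT => H; apply: nirr; split.
    by apply: contraNneq v0 => f0; rewrite -memv0 -f0 memvf.
  move=> W Wst; have [->|W0] := eqVneq W 0%VS; first by left.
  have [->|Wf] := eqVneq W fullv; first by right.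
  by case: H; exists W.
have stW x w : w \in W -> rho x w \in W.
  by move=> wW; apply: (subvP (Wst x)); apply: memv_img.
have dW : (\dim W < \dim {:V})%N.
  by rewrite ltn_neqAle (dimv_leqif_eq (subvf W)) Wf dimvS ?subvf.
have [vW|vW] := boolP (v \in W).
  have [rho' rho'E] := compression rho W \1%VF.
  have [|i iE] := @lfun_exists _ (subvs_of W) V vsval; first exact: (linearP vsval).
  have iint x w : i (rho' x w) = rho x (i w).
    by rewrite !iE rho'E id_lfunE vsprojK // stW ?subvsP.
  have iinj : injective i by move=> a b; rewrite !iE; apply: val_inj.
  apply: (IH _ rho').
  - exact: sub_representation iinj iint rr.
  - have iv : i (vsproj W v) = v by rewrite iE vsprojK.
    exists (vsproj W v); split.
    + by apply: contraNneq v0 => E; rewrite -iv E linear0.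
    + move/weight_spaceP: vl => vl; apply/weight_spaceP => h; apply: iinj.
      by rewrite iint iv lfunZ iv vl.
    + by move=> alpha Pa x xa; apply: iinj; rewrite iint iv linear0 (vP _ Pa).
  - rewrite dimvf; apply: leq_trans dV; exact: dW.
(* The quotient is realized on a complement [U] of [W], [p] being the projection along [W]. *)
pose U := (W^C)%VS; pose p := daddv_pi U W.
have UW : (U :&: W = 0)%VS by rewrite capvC capv_compl.
have pU u : p u \in U by apply: memv_pi.
have pW u : u - p u \in W.
  have : u \in (U + W)%VS by rewrite addvC addv_complf memvf.
  by move=> /(daddv_pi_add UW) E; rewrite -{1}E /p addrC addKr memv_pi.
have p0 w : w \in W -> p w = 0.
  move=> wW; apply/eqP; rewrite -memv0 -UW memv_cap pU.
  by rewrite -[p w](subKr w) memvB.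
have pid u : u \in U -> p u = u by apply: daddv_pi_id.
have [rho' rho'E] := compression rho U p.
have [|q qE] := @lfun_exists _ V (subvs_of U) (fun v => vsproj U (p v)).
  by move=> c a b; rewrite lfunD lfunZ linearP.
have qint x w : q (rho x w) = rho' x (q w).
  rewrite !qE rho'E vsprojK //; congr (vsproj U _).
  have -> : rho x w = rho x (p w) + rho x (w - p w) by rewrite -lfunD addrC subrK.
  by rewrite lfunD [p (rho x (w - p w))]p0 ?addr0 //; apply: stW; apply: pW.
have qsurj u : exists w, q w = u.
  by exists (vsval u); rewrite qE pid ?subvsP // vsvalK.
apply: (IH _ rho').
- exact: quotient_representation qsurj qint rr.
- exists (q v); split.
  + apply: contraNneq vW => /(congr1 vsval); rewrite qE vsprojK // linear0 => pv0.
    by have := pW v; rewrite pv0 subr0.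
  + move/weight_spaceP: vl => vl; apply/weight_spaceP => h.
    by rewrite -qint vl lfunZ.
  + by move=> alpha Pa x xa; rewrite -qint (vP _ Pa) // linear0.
- rewrite dimvf; apply: leq_trans dV.
  have -> : dim (subvs_of U) = \dim U by [].
  by rewrite dimv_compl ltn_subrL lt0n dimv_eq0 W0 (leq_ltn_trans _ dW).
Qed.

End HighestWeight.

(** * Exterior powers of the adjoint representation *)

Section ExteriorPower.
Context (F : fieldType) (g : lieAlgType F) (n : nat) (e : n.-tuple g).
Hypothesis be : basis_of {:g} e.
Implicit Types (x y : g).

Definition ad_mx x : 'M[F]_n := \matrix_(p, i) coord e p (bracket x e`_i).

Lemma ad_mx_linear : linear ad_mx.
Proof.
by move=> c x y; apply/matrixP => p i; rewrite !mxE brDl brZl linearP.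
Qed.

Lemma ad_mx_br x y : ad_mx (bracket x y) = ad_mx x *m ad_mx y - ad_mx y *m ad_mx x.
Proof.
have H u v (p i : 'I_n) : (ad_mx u *m ad_mx v) p i
    = coord e p (bracket u (bracket v e`_i)).
  rewrite mxE [in RHS](coord_basis be (memvf (bracket v _))) brsumr linear_sum /=.
  by apply: eq_bigr => q _; rewrite !mxE brZr linearZ /= mulrC.
apply/matrixP => p i; rewrite [RHS]mxE [X in _ + X]mxE !H mxE.
by rewrite (brJ x y) linearD /= addrK.
Qed.

Context (S : {set 'I_n}).
Notation k := #|S|.
Notation J := {ffun 'I_k -> 'I_n}.
Notation W := {ffun J -> F^o}.
Implicit Types (f : J) (j l : 'I_k) (i p : 'I_n) (T : W).

Definition set_entry f j i : J := [ffun l => if l == j then i else f l].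

(* The k-th tensor power of g is modelled by its coordinate functions on
   multi-indices. *)
Definition tensor_act x T : W :=
  [ffun f : J => \sum_(j < k) \sum_(i < n) ad_mx x (f j) i * (T (set_entry f j i) : F)].

Lemma tensor_actr x : linear (tensor_act x).
Proof.
move=> c T T'; apply/ffunP => f; rewrite !ffunE scaler_sumr -big_split.
apply: eq_bigr => j _; rewrite /= scaler_sumr -big_split; apply: eq_bigr => i _.
by rewrite !ffunE /= mulrDr; congr (_ + _); rewrite mulrCA.
Qed.

Lemma tensor_actl T : linear (tensor_act^~ T).
Proof.
move=> c x y; apply/ffunP => f; rewrite !ffunE scaler_sumr -big_split.
apply: eq_bigr => j _; rewrite /= scaler_sumr -big_split; apply: eq_bigr => i _.
by rewrite ad_mx_linear /= !mxE mulrDl; congr (_ + _); rewrite -mulrA.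
Qed.

Lemma set_entry_same f j i i' : set_entry (set_entry f j i) j i' = set_entry f j i'.
Proof. by apply/ffunP => l; rewrite !ffunE; case: eqP. Qed.

Lemma set_entryC f j i l i' : j != l ->
  set_entry (set_entry f j i) l i' = set_entry (set_entry f l i') j i.
Proof.
move=> jl; apply/ffunP => m; rewrite !ffunE.
by case: (eqVneq m l) => // ->; rewrite eq_sym (negPf jl).
Qed.

Lemma tensor_act_br x y T : tensor_act (bracket x y) T
  = tensor_act x (tensor_act y T) - tensor_act y (tensor_act x T).
Proof.
apply/ffunP => f.
(* [E] collects the terms in which the two operators act on different tensor factors; it is
   symmetric, so only the terms on a single factor contribute to the commutator. *)
pose E u v := \sum_j \sum_(l | l != j) \sum_i \sum_i'
  ad_mx u (f j) i * (ad_mx v (f l) i' * (T (set_entry (set_entry f j i) l i') : F)).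
have EC u v : E u v = E v u.
  rewrite /E (exchange_big_dep predT) //=; apply: eq_bigr => j _.
  under [RHS]eq_bigl do rewrite eq_sym.
  apply: eq_bigr => l lj; rewrite exchange_big; apply: eq_bigr => i _.
  apply: eq_bigr => i' _; rewrite [in LHS]set_entryC 1?eq_sym //. exact: mulrCA.
have SS u v : tensor_act u (tensor_act v T) f
    = (\sum_j \sum_i (ad_mx u *m ad_mx v) (f j) i * (T (set_entry f j i) : F)) + E u v.
  rewrite ffunE -big_split; apply: eq_bigr => j _ /=.
  have -> : \sum_i ad_mx u (f j) i * (tensor_act v T (set_entry f j i) : F)
     = \sum_i (ad_mx u (f j) i * (\sum_i' ad_mx v i i' * (T (set_entry f j i') : F))
     + \sum_(l | l != j) \sum_i' ad_mx u (f j) i *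
         (ad_mx v (f l) i' * (T (set_entry (set_entry f j i) l i') : F))).
    apply: eq_bigr => i _; rewrite ffunE (bigD1 j) //= mulrDr; congr (_ + _).
      congr (_ * _); apply: eq_bigr => i' _; rewrite ffunE eqxx.
      by rewrite set_entry_same.
    rewrite mulr_sumr; apply: eq_bigr => l lj; rewrite mulr_sumr.
    by apply: eq_bigr => i' _; rewrite ffunE (negPf lj).
  rewrite big_split /=; congr (_ + _); last by rewrite exchange_big.
  under eq_bigr do rewrite mulr_sumr.
  rewrite exchange_big; apply: eq_bigr => i _ /=.
  by rewrite mxE mulr_suml; apply: eq_bigr => i' _; rewrite mulrA.
rewrite [RHS]ffunE [X in _ + X]ffunE !SS (EC y x) opprD addrACA subrr addr0.
rewrite ffunE -sumrB; apply: eq_bigr => j _; rewrite -sumrB; apply: eq_bigr => i _.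
by rewrite ad_mx_br !mxE mulrBl.
Qed.

Definition minor_mx f : 'M[F]_k := \matrix_(l, j) (enum_val l == f j)%:R.

(* The coordinates of the pure wedge of the e_i, i in S, are minors. *)
Definition wedge : W := [ffun f : J => \det (minor_mx f)].

Lemma wedge_neq0 : wedge != 0.
Proof.
apply/eqP => /ffunP/(_ [ffun l => enum_val l]); rewrite !ffunE.
have -> : minor_mx [ffun l => enum_val l] = 1%:M.
  by apply/matrixP => l j; rewrite !mxE ffunE (inj_eq enum_val_inj).
by rewrite det1 => /eqP; rewrite oner_eq0.
Qed.

(** The [e_i] with [i] in [S] span an [ad x]-stable subspace, and the wedge of a basis of it is
    scaled by the trace of [ad x] on it. *)
Lemma wedge_act x : (forall i p, i \in S -> ad_mx x p i != 0 -> p \in S) ->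
  tensor_act x wedge = (\sum_(i in S) ad_mx x i i) *: wedge.
Proof.
move=> xS; apply/ffunP => f; rewrite !ffunE.
pose B := minor_mx f; pose s (l : 'I_k) : 'I_n := enum_val l.
(* Expansion along the replaced column, which does not enter the cofactors. *)
have -> : \sum_j \sum_i ad_mx x (f j) i * (wedge (set_entry f j i) : F)
   = \sum_j \sum_l ad_mx x (f j) (s l) * cofactor B l j.
  apply: eq_bigr => j _.
  under eq_bigr => i _.
    rewrite ffunE (expand_det_col _ j) mulr_sumr.
    have -> : \sum_l ad_mx x (f j) i * (minor_mx (set_entry f j i) l j *
        cofactor (minor_mx (set_entry f j i)) l j)
      = \sum_l ad_mx x (f j) i * ((s l == i)%:R * cofactor B l j).
      apply: eq_bigr => l _; congr (_ * (_ * _)); first by rewrite mxE ffunE eqxx.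
      rewrite /cofactor; congr (_ * \det _); apply/matrixP => a b.
      by rewrite !mxE ffunE [lift _ _ == _]eq_sym (negPf (neq_lift _ _)).
    over.
  rewrite exchange_big; apply: eq_bigr => l _ /=.
  rewrite (bigD1 (s l)) //= eqxx mul1r big1 ?addr0 // => i.
  by rewrite eq_sym => /negPf ->; rewrite mul0r mulr0.
(* By stability the sum over all indices restricts to [S], which turns the entries into combinations
   of rows of [B]. *)
have sS p l : ad_mx x p (s l) = \sum_l' ad_mx x (s l') (s l) * (s l' == p)%:R.
  rewrite -(big_enum_val (A := mem S) (fun p' => ad_mx x p' (s l) * (p' == p)%:R)).
  have [pS|pS] := boolP (p \in S).
    rewrite (bigD1 p) //= eqxx mulr1 big1 ?addr0 // => q /andP[_ /negPf ->].
    by rewrite mulr0.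
  rewrite big1 => [|q qS]; last first.
    by case: eqP => [qp|_]; rewrite ?mulr0 // -qp qS in pS *.
  by apply/eqP; apply: contraNT pS; apply: xS; apply: enum_valP.
under eq_bigr => j _ do under eq_bigr => l _ do rewrite sS mulr_suml.
rewrite exchange_big /=; under eq_bigr do rewrite exchange_big /=.
rewrite [RHS]mulr_suml (big_enum_val (A := mem S) (fun i => ad_mx x i i * \det B)).
apply: eq_bigr => l _; rewrite (bigD1 l) //= [X in _ + X]big1 ?addr0 => [|l' l'l].
  rewrite (expand_det_row B l) mulr_sumr; apply: eq_bigr => j _.
  by rewrite -mulrA; congr (_ * (_ * _)); rewrite mxE.
(* Off the diagonal, a row of [B] meets the cofactors of another row, and the adjugate identity
   gives 0. *)
have := congr1 (fun M : 'M_k => M l' l) (mul_mx_adj B).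
rewrite mxE [RHS]mxE (negPf l'l) mulr0n => E.
transitivity (ad_mx x (s l') (s l) * \sum_j B l' j * (\adj B) j l); last first.
  by rewrite E mulr0.
rewrite mulr_sumr; apply: eq_bigr => j _.
by rewrite -mulrA; congr (_ * (_ * _)); rewrite mxE.
Qed.

End ExteriorPower.

(** A positive root vector strictly raises the value of weights at [h0], so it preserves the span of
    the upward closed [S] and has zero diagonal on it. *)
Lemma wedge_highest_weight (F : numFieldType) (g : lieAlgType F) (t : {vspace g})
    (Pos : set (dual t)) (h0 : subvs_of t) (n : nat) (e : n.-tuple g) wt
    (S : {set 'I_n}) :
  weighted (ad g) e wt ->
  (forall alpha, Pos alpha -> 0 < (alpha h0 : F)) ->
  (forall i p : 'I_n, i \in S -> (wt e`_i h0 : F) < wt e`_p h0 -> p \in S) ->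
  highest_weight_of Pos (\sum_(i in S) wt e`_i).
Proof.
move=> ewt pos up; have be : basis_of {:g} e by case: ewt.
have [||act actE] := lfun2_exists (f := @tensor_act F g n e S).
- exact: tensor_actr.
- exact: tensor_actl.
have we (i : 'I_n) : e`_i \in weight_space (ad g) (wt e`_i).
  by apply: ewt.2; rewrite mem_nth ?size_tuple.
exists {ffun {ffun 'I_#|S| -> 'I_n} -> F^o}, act; split.
  by move=> x y T; rewrite !actE (tensor_act_br be).
exists (wedge F S); split; first exact: wedge_neq0.
  apply/weight_spaceP => h; rewrite actE.
  have adh (i p : 'I_n) : ad_mx e (vsval h) p i = (wt e`_i h : F) *+ (i == p).
    rewrite mxE -adE (weighted_eigen ewt) linearZ /= coord_free ?(basis_free be) //.
    by rewrite mulr_natr.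
  rewrite wedge_act; last first.
    by move=> i p iS; rewrite adh; case: (eqVneq i p) => [<-|_]; rewrite ?mulr0n ?eqxx.
  congr (_ *: _); rewrite sum_lfunE; apply: eq_bigr => i _.
  by rewrite adh eqxx.
move=> alpha Pa x xa; rewrite actE.
have adx (i p : 'I_n) : ad_mx e x p i != 0 -> wt e`_p = alpha + wt e`_i.
  rewrite mxE; apply: (weighted_coord ewt); rewrite -adE.
  by apply: weight_spaceD => //; apply: ad_rep.
rewrite wedge_act.
  rewrite big1 ?scale0r // => i _; apply: contrapT => /eqP/adx/eqP.
  rewrite -subr_eq subrr eq_sym => /eqP a0; have := pos _ Pa.
  by rewrite a0 zero_lfunE ltxx.
move=> i p iS /adx wp; apply: (up i) => //.
by rewrite wp add_lfunE ltrDr pos.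
Qed.

(** * The Casimir operator *)

Lemma eigen_exists (C : closedFieldType) (V : vectType C) (f : 'End(V)) (v : V) :
  v != 0 -> exists (c : C) (w : V), w != 0 /\ f w = c *: w.
Proof.
move=> v0; have [cs [p [_ pE _ pge]]] := gen_eigen_decomp f.
have [c ccs pv] : exists2 c, c \in cs & p c v != 0.
  apply: contrapT => H; case/eqP: v0; rewrite (pE v) big_seq big1 // => c ccs.
  by apply: contrapT => /eqP pv; apply: H; exists c.
have [n] := pge c v ccs; elim: n (p c v) pv => [|n IH] w w0.
  by move=> /= w00; rewrite w00 eqxx in w0.
have [fw _|fw] := eqVneq ((f - c *: \1)%VF w) 0; last by rewrite iterSr; apply: IH.
by exists c, w; split=> //; apply/eqP; rewrite -subr_eq0 -shiftE fw.
Qed.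

Section HighestWeightFormula.
Context (C : numClosedFieldType) (g : lieAlgType C) (t : {vspace g}).
Context (Pos : set (dual t)).
Hypotheses (g_simple : simple_lie g) (t_cartan : cartan_subalgebra t).
Hypothesis Pos_positive : positive_roots Pos.
Implicit Types (x y z : g) (mu alpha lambda : dual t) (h : subvs_of t).

Lemma pos_or_neg_root alpha : Defs.roots alpha -> Pos alpha \/ Pos (- alpha).
Proof.
have [h [hreal ->]] := Pos_positive => ra.
have [areal a0] := hreal _ ra; rewrite /=.
move: areal; rewrite realE => /orP[ah|ah]; [left|right].
- by split; [exact: ra|rewrite lt_def a0 ah].
- split; first exact: (rootN g_simple t_cartan ra).
  by rewrite opp_lfunE oppr_gt0 lt_neqAle a0 ah.
Qed.

Lemma pos_root alpha : Pos alpha -> Defs.roots alpha.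
Proof. by have [h [_ ->]] := Pos_positive => -[]. Qed.

Lemma finite_pos : finite_set Pos.
Proof.
apply: sub_finite_set (@finite_weights _ g t g (ad g)).
by move=> alpha /pos_root[].
Qed.

(** Schur's argument: the operator [A] relating the two forms commutes with [ad], so its eigenspace
    for some eigenvalue is a nonzero ideal, hence all of [g]. *)
Lemma trform_killing (V : vectType C) (rho : 'Hom(g, 'End(V))) :
  representation rho ->
  exists c, forall x y, trform rho x y = c * killing x y.
Proof.
move=> rr; have [T TE] := trform_lfun (ad g); have [B BE] := trform_lfun rho.
have nd := killing_nondeg g_simple t_cartan.
have TT l : T ((T^-1)%VF l) = l.
  apply: limg_lfunVK; have [|x <-] := form_represent (T := T) _ l.
    by move=> x x0; apply: nd => y; rewrite killingE -TE x0.
  exact: memv_img (memvf x).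
pose A : 'End(g) := (T^-1 \o B)%VF.
have AE x y : killing (A x) y = trform rho x y.
  by rewrite killingE -TE comp_lfunE TT BE.
have [x0 [y0 xy0]] := g_simple.1.
have x00 : x0 != 0 by apply: contraNneq xy0 => ->; rewrite br0l.
have [c [w [w0 Aw]]] := eigen_exists A x00.
have Iid : lie_ideal (lker (A - c *: \1)%VF).
  move=> x y; rewrite !memv_ker !shiftE !subr_eq0 => /eqP Ay.
  rewrite -brZr -Ay; apply/eqP/eqP; rewrite -subr_eq0; apply/eqP/nd => z.
  rewrite killingE -scaleN1r trformDl trformZl -!killingE AE mulN1r.
  rewrite [bracket x y]brC [bracket x _]brC -!scaleN1r trformZl killingE trformZl.
  rewrite -killingE killing_inv AE trform_inv //.
  by rewrite subrr.
exists c => x y; rewrite -AE; case: (g_simple.2 _ Iid) => If.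
  have : w \in lker (A - c *: \1)%VF by rewrite memv_ker shiftE Aw subrr.
  by rewrite If memv0 (negPf w0).
have : x \in lker (A - c *: \1)%VF by rewrite If memvf.
by rewrite memv_ker shiftE subr_eq0 => /eqP ->; rewrite killingE trformZl.
Qed.

(** The sum of the weight spaces is invariant, because [g] itself is spanned by weight vectors, and
    it contains the highest weight vector. *)
Lemma irreducible_weight_spanned (V : vectType C) (rho : 'Hom(g, 'End(V))) lambda :
  representation rho -> irreducible_rep rho -> highest_weight Pos rho lambda ->
  weight_spanned t rho.
Proof.
move=> rr [_ irr] [v [v0 vl _]].
pose X := flatten [seq (vbasis (weight_space rho mu) : seq V)
  | mu <- finmap.enum_fset (fset_set (@weights _ g t V rho))].
have memX mu w : w \in weight_space rho mu -> w \in <<X>>%VS.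
  move=> wmu; have [->|w0] := eqVneq w 0; first exact: mem0v.
  have : w \in <<vbasis (weight_space rho mu)>>%VS by rewrite (span_basis (vbasisP _)).
  apply/subvP/sub_span => u uB; apply/flattenP.
  exists (vbasis (weight_space rho mu) : seq V) => //; apply: map_f.
  rewrite in_fset_set ?inE; last exact: finite_weights.
  by apply: contraNneq w0 => E0; rewrite -memv0 -E0.
have Xw u : u \in X -> exists mu : dual t, u \in weight_space rho mu.
  by move=> /flattenP[_ /mapP[mu _ ->] /vbasis_mem umu]; exists mu.
have stX x : (rho x @: <<X>> <= <<X>>)%VS.
  apply/subvP => _ /memv_imgP[w wX ->]; move: w wX.
  apply: span_ind => [|a b|c a|a /Xw[mu amu]].
  - by rewrite linear0 mem0v.
  - by rewrite lfunD; apply: memvD.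
  - by rewrite lfunZ; apply: memvZ.
  have [xs -> xsP] := ad_weight_spanned g_simple t_cartan x.
  rewrite lfun_sum sum_lfunE big_seq memv_suml // => x' /xsP[alpha x'a].
  by apply: (memX (alpha + mu)); apply: weight_spaceD.
have [X0|Xf] := irr _ stX.
  by have := memX _ _ vl; rewrite X0 memv0 (negPf v0).
move=> u; have : u \in <<X>>%VS by rewrite Xf memvf.
move: u; apply: span_ind => [|a b [wa -> waP] [wb -> wbP]|c a [wa -> waP]|a /Xw aw].
- by exists [::]; rewrite ?big_nil.
- exists (wa ++ wb); first by rewrite big_cat.
  by move=> w; rewrite mem_cat => /orP[/waP|/wbP].
- exists [seq c *: w | w <- wa]; first by rewrite big_map scaler_sumr.
  by move=> _ /mapP[w /waP[mu wmu] ->]; exists mu; apply: memvZ.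
- by exists [:: a]; rewrite ?big_seq1 // => w; rewrite inE => /eqP ->.
Qed.

Lemma highest_weight_dominant (V : vectType C) (rho : 'Hom(g, 'End(V))) lambda :
  representation rho -> highest_weight Pos rho lambda -> dominant_weight Pos lambda.
Proof.
move=> rr [v [v0 vl vP]] alpha Pa; have ra := pos_root Pa.
have : vpick (weight_space (ad g) alpha) != 0 by rewrite vpick0; case: ra.
set x := vpick _; have xa : x \in weight_space (ad g) alpha by apply: memv_pick.
move=> /(killing_dual_exists g_simple t_cartan xa)[y ya xy].
exact: (root_highest_integral g_simple t_cartan rr ra xa ya xy vl v0 (vP _ Pa _ xa)).
Qed.

Lemma corootD mu alpha : coroot (mu + alpha) = coroot mu + coroot alpha.
Proof. by rewrite /coroot lfunD. Qed.

Lemma corootZ c mu : coroot (c *: mu) = c *: coroot mu.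
Proof. by rewrite /coroot lfunZ. Qed.

Lemma killing_dualC mu alpha : killing_dual mu alpha = killing_dual alpha mu.
Proof. exact: killingC. Qed.

Lemma killing_dualDr mu alpha beta :
  killing_dual mu (alpha + beta) = killing_dual mu alpha + killing_dual mu beta.
Proof. by rewrite -[LHS]/(killing (coroot _) (coroot _)) corootD killingE trformDr. Qed.

Lemma killing_dualZr c mu alpha :
  killing_dual mu (c *: alpha) = c * killing_dual mu alpha.
Proof. by rewrite -[LHS]/(killing (coroot _) (coroot _)) corootZ killingE trformZr. Qed.

Lemma killing_dualDl mu alpha beta :
  killing_dual (alpha + beta) mu = killing_dual alpha mu + killing_dual beta mu.
Proof. by rewrite !(killing_dualC _ mu) killing_dualDr. Qed.

Lemma killing_dualZl c mu alpha :
  killing_dual (c *: alpha) mu = c * killing_dual alpha mu.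
Proof. by rewrite !(killing_dualC _ mu) killing_dualZr. Qed.

Section Casimir.
Context (n : nat) (e : n.-tuple g) (wt : g -> dual t) (ewt : weighted (ad g) e wt).

Let be : basis_of {:g} e. Proof. by case: ewt. Qed.

Lemma dual_basis_exists : exists d : 'I_n -> g,
  forall i y, killing (d i) y = coord e i y.
Proof.
have [T TE] := trform_lfun (ad g).
have H (i : 'I_n) : exists x, forall y, killing x y = coord e i y.
  have [|l lE] := @lfun_exists _ g C^o (fun y => coord e i y).
    by move=> c x y; rewrite linearP.
  have [|x xl] := form_represent (T := T) _ l.
    move=> x x0; apply: (killing_nondeg g_simple t_cartan) => y.
    by rewrite killingE -TE x0.
  by exists x => y; rewrite killingE -TE xl lE.
have [d dP] := choice H; by exists d.
Qed.

Context (d : 'I_n -> g) (dE : forall i y, killing (d i) y = coord e i y).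

Lemma killing_dual_basis (i j : 'I_n) : killing (d i) e`_j = (i == j)%:R.
Proof. by rewrite dE coord_free ?(basis_free be) // eq_sym. Qed.

Lemma basis_expand y : y = \sum_(i < n) killing (d i) y *: e`_i.
Proof.
rewrite {1}(coord_basis be (memvf y)); apply: eq_bigr => i _.
by rewrite dE.
Qed.

Lemma dual_basis_expand y : y = \sum_(i < n) killing e`_i y *: d i.
Proof.
apply/eqP; rewrite -subr_eq0; apply/eqP; apply: (killing_nondeg g_simple t_cartan) => z.
have [T TE] := trform_lfun (ad g).
rewrite killingE -TE lfunB lfun_sum add_lfunE opp_lfunE sum_lfunE.
apply/eqP; rewrite subr_eq0 {1}(basis_expand z) lfun_sum; apply/eqP.
apply: eq_bigr => i _.
rewrite !lfunZ scale_lfunE !TE -!killingE (killingC y); exact: mulrC.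
Qed.

Lemma dual_basis_weight (i : 'I_n) : d i \in weight_space (ad g) (- wt e`_i).
Proof.
apply/weight_spaceP => h; rewrite opp_lfunE scaleNr adE.
apply/eqP; rewrite -subr_eq0 opprK; apply/eqP.
apply: (killing_nondeg g_simple t_cartan) => y.
rewrite killingE trformDl trformZl -!killingE brC -scaleN1r.
rewrite [killing (_ *: _) _]trformZl.
rewrite -killingE killing_inv !dE mulN1r.
rewrite {1}(coord_basis be (memvf y)) brsumr.
have -> : \sum_(j < n) bracket (vsval h) (coord e j y *: e`_j)
    = \sum_(j < n) (coord e j y * (wt e`_j h : C)) *: e`_j.
  by apply: eq_bigr => j _; rewrite brZr -adE (weighted_eigen ewt) scalerA.
by rewrite coord_sum_free ?(basis_free be) // mulrC addNr.
Qed.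

Context (V : vectType C) (rho : 'Hom(g, 'End(V))) (rr : representation rho).

Definition casimir : 'End(V) := \sum_(i < n) (rho e`_i \o rho (d i))%VF.

(** The brackets of [x] with the two dual bases are expanded in these bases; invariance makes the
    coefficients cancel in pairs. *)
Lemma casimir_comm x v : casimir (rho x v) = rho x (casimir v).
Proof.
apply/eqP; rewrite eq_sym -subr_eq0; apply/eqP.
rewrite /casimir !sum_lfunE lfun_sum -sumrB.
have -> : \sum_(i < n) (rho x ((rho e`_i \o rho (d i))%VF v)
     - (rho e`_i \o rho (d i))%VF (rho x v))
  = \sum_(i < n) rho (bracket x e`_i) (rho (d i) v)
   + \sum_(i < n) rho e`_i (rho (bracket x (d i)) v).
  rewrite -big_split; apply: eq_bigr => i _ /=.
  by rewrite !comp_lfunE !rr lfunB addrA subrK.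
have -> : \sum_(i < n) rho (bracket x e`_i) (rho (d i) v)
  = \sum_(i < n) \sum_(j < n) killing (d j) (bracket x e`_i) *: rho e`_j (rho (d i) v).
  apply: eq_bigr => i _; rewrite {1}[bracket x _]basis_expand lfun_sum sum_lfunE.
  by apply: eq_bigr => j _; rewrite lfunZ scale_lfunE.
have -> : \sum_(i < n) rho e`_i (rho (bracket x (d i)) v)
  = \sum_(i < n) \sum_(j < n) killing e`_j (bracket x (d i)) *: rho e`_i (rho (d j) v).
  apply: eq_bigr => i _; rewrite {1}[bracket x _]dual_basis_expand !lfun_sum sum_lfunE.
  by rewrite lfun_sum; apply: eq_bigr => j _; rewrite lfunZ scale_lfunE lfunZ.
rewrite [X in _ + X]exchange_big -big_split big1 //= => i _.
rewrite -big_split big1 //= => j _; rewrite -scalerDl.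
rewrite -(killing_inv (d j)) [bracket (d j) x]brC -scaleN1r killingE trformZl.
by rewrite -killingE mulN1r killingC addNr scale0r.
Qed.

End Casimir.
End HighestWeightFormula.

(** * The Casimir scalar and the power sums of an irreducible representation *)

Section PowerSumFormula.
Context (C : numClosedFieldType) (g : lieAlgType C) (t : {vspace g}).
Context (Pos : set (dual t)).
Hypotheses (g_simple : simple_lie g) (t_cartan : cartan_subalgebra t).
Hypothesis Pos_positive : positive_roots Pos.
Implicit Types (x y z : g) (mu alpha lambda : dual t) (h : subvs_of t).

Lemma killing_dual_half_sum lambda n (e : n.-tuple g) (wt : g -> dual t) :
  weighted (ad g) e wt ->
  \sum_(i < n) (if `[< Pos (wt e`_i) >] then killing_dual lambda (wt e`_i) else 0)
    = 2 * killing_dual lambda (half_sum Pos).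
Proof.
move=> ewt; rewrite /half_sum killing_dualZr mulrA divff ?pnatr_eq0 // mul1r.
have fP := finite_pos Pos_positive.
rewrite fsbig_finite //=; set s := finmap.enum_fset _.
have sP alpha : alpha \in s <-> Pos alpha.
  rewrite /s in_fset_set //; split; last by move=> Pa; rewrite inE.
  by rewrite inE.
have us : uniq s by exact: finmap.fset_uniq.
have kdsum (r : seq (dual t)) : killing_dual lambda (\sum_(alpha <- r) alpha)
    = \sum_(alpha <- r) killing_dual lambda alpha.
  elim: r => [|alpha r IH]; last by rewrite !big_cons killing_dualDr IH.
  by rewrite !big_nil -[0 : dual t](scale0r (0 : dual t)) killing_dualZr mul0r.
rewrite kdsum.
transitivity (\sum_(i < n) \sum_(alpha <- s)
    (if wt e`_i == alpha then killing_dual lambda alpha else 0)).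
  apply: eq_bigr => i _; case: asboolP => [/sP Pi|nP].
    rewrite (bigD1_seq (wt e`_i)) //= eqxx big1 ?addr0 // => alpha.
    by rewrite eq_sym => /negPf ->.
  rewrite big_seq big1 // => alpha /sP Pa; case: eqP => // E.
  by case: nP; rewrite E.
rewrite exchange_big /= !big_seq; apply: eq_bigr => alpha /sP Pa.
(* Root spaces are lines, so each positive root is the weight of exactly one basis vector. *)
have := root_mult g_simple t_cartan (pos_root Pos_positive Pa).
rewrite (weighted_mult ewt) -sum1_count (big_nth 0) size_tuple big_mkord => m1.
rewrite -big_mkcond /= sumr_const -sum1_card.
rewrite (eq_bigl (fun i : 'I_n => wt e`_i == alpha)) ?m1 ?mulr1n //.
Qed.

(** Indices of weight 0 contribute (lambda, lambda). For a positive root alpha, [e_i] kills [v], and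
    the bracket t_alpha of the dual pair contributes (lambda, alpha). For a negative root, [d i]
    already kills [v]. *)
Lemma casimir_highest lambda n (e : n.-tuple g) (wt : g -> dual t) d (V : vectType C)
    (rho : 'Hom(g, 'End(V))) (v : V) :
  weighted (ad g) e wt -> (forall i y, killing (d i) y = coord e i y) ->
  representation rho -> v \in weight_space rho lambda ->
  (forall alpha, Pos alpha ->
     forall x, x \in weight_space (ad g) alpha -> rho x v = 0) ->
  casimir e d rho v = (killing_dual lambda lambda
    + 2 * killing_dual lambda (half_sum Pos)) *: v.
Proof.
move=> ewt dE rr vl vP.
have ew (i : 'I_n) : e`_i \in weight_space (ad g) (wt e`_i).
  by apply: ewt.2; rewrite mem_nth ?size_tuple.
have dw i := dual_basis_weight g_simple t_cartan ewt dE i.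
have l0 : coroot lambda \in weight_space (ad g) (0 : dual t).
  by rewrite (weight_space0 g_simple t_cartan) coroot_mem.
rewrite /casimir sum_lfunE -(killing_dual_half_sum lambda ewt).
have -> : killing_dual lambda lambda
   = \sum_(i < n) killing (coroot lambda) e`_i * killing (coroot lambda) (d i).
  rewrite -[LHS]/(killing (coroot lambda) (coroot lambda)).
  have [T TE] := trform_lfun (ad g).
  rewrite {2}(dual_basis_expand g_simple t_cartan ewt dE (coroot lambda)).
  rewrite killingE -TE lfun_sum; apply: eq_bigr => i _.
  by rewrite lfunZ TE -!killingE (killingC e`_i).
rewrite -big_split scaler_suml; apply: eq_bigr => i _ /=; rewrite comp_lfunE.
have [w0|w0] := eqVneq (wt e`_i) 0.
  have et : e`_i \in t by rewrite -(weight_space0 g_simple t_cartan) -w0.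
  have dt : d i \in t.
    by rewrite -(weight_space0 g_simple t_cartan) -[0]oppr0 -w0.
  have tv x : x \in t -> rho x v = killing (coroot lambda) x *: v.
    move=> xt; rewrite -{2}(vsprojK xt) (killing_coroot g_simple t_cartan).
    by move/weight_spaceP: vl => /(_ (vsproj t x)) <-; rewrite vsprojK.
  rewrite (tv _ dt) lfunZ (tv _ et) scalerA mulrC.
  case: asboolP => [/(pos_root Pos_positive)[]|_]; first by rewrite w0 eqxx.
  by rewrite addr0.
have K0 : killing (coroot lambda) e`_i = 0.
  by apply: (killing_weight_orth l0 (ew i)); rewrite add0r.
rewrite K0 mul0r add0r.
have ri : Defs.roots (wt e`_i).
  split=> //; apply: (weighted_weights ewt).
  by rewrite mem_nth ?size_tuple.
have rE : rho e`_i (rho (d i) v) = rho (bracket e`_i (d i)) v + rho (d i) (rho e`_i v).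
  by rewrite rr subrK.
case: asboolP => Pi.
  rewrite rE (vP _ Pi _ (ew i)) linear0 addr0.
  rewrite (root_bracket g_simple t_cartan (ew i) (dw i)) killingC.
  rewrite (killing_dual_basis ewt dE) eqxx scale1r.
  exact: coroot_eigen.
have [//|Pi'] := pos_or_neg_root g_simple t_cartan Pos_positive ri.
by rewrite (vP _ Pi' _ (dw i)) linear0 scale0r.
Qed.

Lemma irreducible_power_sum lambda (V : vectType C) (rho : 'Hom(g, 'End(V))) h :
  representation rho -> irreducible_rep rho -> highest_weight Pos rho lambda ->
  power_sum 1 rho h = 0 /\
  power_sum 2 rho h = ((\dim {:g})%:R^-1 *
     (q2_dual (lambda + half_sum Pos) - q2_dual (half_sum Pos))) * q2 h
     * power_sum 0 rho h.
Proof.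
move=> rr irr hw.
have [f [wf fwt]] := weighted_exists
  (irreducible_weight_spanned g_simple t_cartan rr irr hw).
rewrite (power_sum1 fwt) (power_sum2 fwt) (power_sum0 fwt).
split; first exact: lftrace_rep0 (simple_perfect g_simple) _.
have [e [wt ewt]] := weighted_exists (ad_weight_spanned g_simple t_cartan).
have [d dE] := dual_basis_exists g_simple t_cartan e.
have [c trc] := trform_killing g_simple t_cartan rr.
have [v [v0 vl vP]] := hw.
have Ov := casimir_highest ewt dE rr vl vP.
set q := _ + _ in Ov.
(* Schur's argument again: the kernel of the Casimir operator minus [q] is invariant and contains
   [v]. *)
have OE : casimir e d rho = q *: \1%VF.
  have [|K0|Kf] := irr.2 (lker (casimir e d rho - q *: \1)%VF).
  - move=> x; apply/subvP => _ /memv_imgP[w + ->].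
    rewrite !memv_ker !add_lfunE !opp_lfunE !scale_lfunE !id_lfunE !subr_eq0.
    by rewrite (casimir_comm g_simple t_cartan ewt dE rr) => /eqP ->; rewrite lfunZ.
  - have : v \in lker (casimir e d rho - q *: \1)%VF.
      by rewrite memv_ker add_lfunE opp_lfunE scale_lfunE id_lfunE Ov subrr.
    by rewrite K0 memv0 (negPf v0).
  apply/lfunP => w; have : w \in lker (casimir e d rho - q *: \1)%VF.
    by rewrite Kf memvf.
  by rewrite memv_ker add_lfunE opp_lfunE subr_eq0 => /eqP.
have := congr1 (@lftrace _ V) OE.
rewrite lftraceZ lftrace_id /casimir lftrace_sum.
(* Each dual pair has Killing product 1, so it contributes [c] to the trace. *)
have -> : \sum_(i < \dim {:g}) lftrace (rho e`_i \o rho (d i))%VF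
    = c * (\dim {:g})%:R.
  rewrite (eq_bigr (fun=> c)); first by rewrite sumr_const card_ord mulr_natr.
  move=> i _; rewrite -/(trform rho _ _) trc killingC (killing_dual_basis ewt dE).
  by rewrite eqxx mulr1.
have dim0 : (\dim {:g})%:R != 0 :> C.
  rewrite pnatr_eq0 dimv_eq0; have [[x [y xy]] _] := g_simple.
  by apply: contraNneq xy => f0; rewrite -memv0 -f0 memvf.
move=> cE; rewrite trc.
have -> : q2_dual (lambda + half_sum Pos) - q2_dual (half_sum Pos) = q.
  rewrite /q2_dual killing_dualDr !killing_dualDl (killing_dualC (half_sum Pos)).
  by rewrite !addrA addrK /q mulr_natl mulr2n addrA.
have -> : c = (\dim {:g})%:R^-1 * (q * (\dim {:V})%:R) by rewrite -cE mulrC mulfK.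
by rewrite /q2 -!mulrA [_%:R * killing _ _]mulrC.
Qed.

End PowerSumFormula.

(** * Zariski density *)

Section Density.
Context (F : numFieldType) (U : vectType F).
Implicit Types (p q : U -> F) (u w : U).

(** Weaker than [polyfun], but enough for density, and immediate for the restriction of [P k] to a
    fixed [nu]. *)
Definition line_poly p := forall u w,
  exists q : {poly F}, forall c, p (u + c *: w) = q.[c].

Lemma line_polyD p q : line_poly p -> line_poly q -> line_poly (fun u => p u + q u).
Proof.
move=> Hp Hq u w; have [a aE] := Hp u w; have [b bE] := Hq u w.
by exists (a + b) => c; rewrite hornerD aE bE.
Qed.

Lemma line_polyM p q : line_poly p -> line_poly q -> line_poly (fun u => p u * q u).
Proof.
move=> Hp Hq u w; have [a aE] := Hp u w; have [b bE] := Hq u w.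
by exists (a * b) => c; rewrite hornerM aE bE.
Qed.

Lemma line_poly_cst (a : F) : line_poly (fun=> a).
Proof. by move=> u w; exists a%:P => c; rewrite hornerC. Qed.

Lemma polyfun_line p : polyfun p -> line_poly p.
Proof.
elim=> [a|l|p1 p2 _ H1 _ H2|p1 p2 _ H1 _ H2].
- exact: line_poly_cst.
- move=> u w; exists ((l u : F)%:P + (l w : F) *: 'X) => c.
  by rewrite lfunD lfunZ hornerD hornerC hornerZ hornerX mulrC.
- exact: line_polyD.
- exact: line_polyM.
Qed.

Lemma poly_nat_roots (q : {poly F}) : (forall n : nat, q.[n%:R] = 0) -> q = 0.
Proof.
move=> q0; apply: contrapT => /eqP qn0.
have := @max_poly_roots _ q [seq i%:R | i <- iota 0 (size q)] qn0.
rewrite size_map size_iota ltnn => H; apply: notF; apply: H.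
  by apply/allP => _ /mapP[i _ ->]; rewrite rootE q0.
rewrite map_inj_uniq ?iota_uniq // => i j /eqP.
by rewrite eqr_nat => /eqP.
Qed.

(* Along each direction in L, p restricts to a polynomial vanishing on the naturals. *)
Lemma line_poly_eq0 p (M : U -> Prop) (L : seq U) : line_poly p ->
  (forall u w, M u -> M w -> M (u + w)) -> (forall u, M u -> p u = 0) ->
  (forall u, u \in L -> M u) ->
  forall u w, M u -> w \in <<L>>%VS -> p (u + w) = 0.
Proof.
move=> pl MD p0; elim: L => [|l L IH] LM u w Mu.
  by rewrite span_nil memv0 => /eqP ->; rewrite addr0 p0.
have Ml : M l by apply: LM; rewrite mem_head.
rewrite span_cons => /memv_addP[_ /vlineP[c ->] [x xL ->]].
have [q qE] := pl (u + x) l.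
have -> : u + (c *: l + x) = u + x + c *: l by rewrite [_ + x]addrC addrA.
rewrite qE; suff -> : q = 0 by rewrite horner0.
apply: poly_nat_roots => n; rewrite -qE addrAC IH //.
  by move=> v vL; apply: LM; rewrite inE vL orbT.
by rewrite scaler_nat; elim: n => [|n IHn]; rewrite ?addr0 // mulrSr addrA; apply: MD.
Qed.

End Density.

(** * Spanning by highest weights and extension to all weights *)

Lemma highest_weights_span (C : numClosedFieldType) (g : lieAlgType C)
    (t : {vspace g}) (Pos : set (dual t)) :
  simple_lie g -> cartan_subalgebra t -> positive_roots Pos ->
  exists2 L : seq (dual t),
    forall lambda, lambda \in L -> highest_weight_of Pos lambda & <<L>>%VS = fullv.
Proof.
move=> g_simple t_cartan Pos_positive.
have [e [wt ewt]] := weighted_exists (ad_weight_spanned g_simple t_cartan).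
have be : basis_of {:g} e by case: ewt.
have [h0 [_ PosE]] := Pos_positive.
have pos alpha : Pos alpha -> 0 < (alpha h0 : C) by rewrite PosE => -[].
set n := \dim {:g} in e ewt be *.
pose S (i : 'I_n) := [set j : 'I_n | (wt e`_i h0 : C) < wt e`_j h0].
have iS i : i \notin S i by rewrite inE ltxx.
pose up (i : 'I_n) := \sum_(j in S i) wt e`_j.
pose up' (i : 'I_n) := \sum_(j in i |: S i) wt e`_j.
exists ([seq up i | i <- enum 'I_n] ++ [seq up' i | i <- enum 'I_n]).
  move=> lambda; rewrite mem_cat => /orP[] /mapP[i _ ->].
    apply: (wedge_highest_weight ewt pos) => j p; rewrite !inE.
    exact: lt_trans.
  apply: (wedge_highest_weight ewt pos) => j p; rewrite !inE => /orP[/eqP ->|ij] jp.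
    by rewrite jp orbT.
  by rewrite (lt_trans ij jp) orbT.
apply/eqP; rewrite eqEsubv subvf; apply/subvP => mu _.
(* The weights of [ad] span the dual: mu(h) = K(t_mu, h), computed as a trace in the weight
   basis. *)
have -> : mu = \sum_(i < n) (wt e`_i (vsproj t (coroot mu)) : C) *: wt e`_i.
  apply/lfunP => h; rewrite sum_lfunE -(killing_coroot g_simple t_cartan).
  rewrite -{1}(vsprojK (coroot_mem mu)) killingE /trform.
  rewrite (lftrace_diag (c := fun i : 'I_n => (wt e`_i (vsproj t (coroot mu)) : C)
    * wt e`_i h) be).
    by apply: eq_bigr => i _; rewrite scale_lfunE.
  move=> i; rewrite comp_lfunE (weighted_eigen ewt) lfunZ (weighted_eigen ewt) scalerA.
  by rewrite mulrC.
apply: memv_suml => i _; apply: memvZ.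
have -> : wt e`_i = up' i - up i by rewrite /up' big_setU1 //= addrK.
by apply: memvB; apply: memv_span; rewrite mem_cat map_f ?mem_enum ?orbT.
Qed.

Lemma q2_dual_line_poly (C : numClosedFieldType) (g : lieAlgType C)
    (t : {vspace g}) (delta : dual t) :
  line_poly (fun lambda : dual t => q2_dual (lambda + delta)).
Proof.
move=> u w; exists ((q2_dual (u + delta))%:P
  + (2 * killing_dual (u + delta) w) *: 'X + q2_dual w *: 'X^2) => c.
rewrite addrAC; move: (u + delta) => v.
rewrite !hornerD hornerC !hornerZ hornerX hornerXn /q2_dual.
rewrite killing_dualDl !killing_dualDr !killing_dualZl !killing_dualZr.
by rewrite (killing_dualC w v); ring.
Qed.

Lemma extended_power_sum (C : numClosedFieldType) (g : lieAlgType C)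
    (t : {vspace g}) (Pos : set (dual t)) (P : nat -> dual t * subvs_of t -> C) :
  simple_lie g -> cartan_subalgebra t -> positive_roots Pos ->
  (forall k, extends_power_sum Pos k (P k)) -> forall lambda nu,
  P 1%N (lambda, nu) = 0 /\
  P 2%N (lambda, nu) = ((\dim {:g})%:R^-1 *
    (q2_dual (lambda + half_sum Pos) - q2_dual (half_sum Pos))) * q2 nu
    * P 0%N (lambda, nu).
Proof.
move=> g_simple t_cartan Pos_positive P_ext lambda nu; set delta := half_sum Pos.
have [L LM Lf] := highest_weights_span g_simple t_cartan Pos_positive.
(* Density: the highest weights form a monoid whose members in [L] span the dual, so it suffices to
   check a vanishing on them. *)
have zero_ext (p : dual t -> C) : line_poly p ->
    (forall lambda, highest_weight_of Pos lambda -> p lambda = 0) ->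
    forall lambda', p lambda' = 0.
  move=> pl p0 lambda'; rewrite -[lambda']add0r.
  apply: (line_poly_eq0 pl (@highest_weightD _ g t Pos) p0 LM).
    exact: highest_weight0.
  by rewrite Lf memvf.
have P_line k nu' : line_poly (fun lambda => P k (lambda, nu')).
  have [/polyfun_line Pl _ _] := P_ext k => u w.
  (* A line in the variable [lambda] alone is a line of the product space in the direction
     [(w, 0)]. *)
  have [q qE] := Pl (u, nu') (w, 0); exists q => c; rewrite -qE; congr (P k _).
  by congr (_, _); rewrite /= scaler0 addr0.
have PE lambda' nu' : highest_weight_of Pos lambda' -> P 1%N (lambda', nu') = 0 /\
    P 2%N (lambda', nu') = ((\dim {:g})%:R^-1 *
      (q2_dual (lambda' + delta) - q2_dual delta)) * q2 nu' * P 0%N (lambda', nu').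
  move=> /highest_weight_irreducible[V [rho [rr irr hw]]].
  have dom := highest_weight_dominant g_simple t_cartan Pos_positive rr hw.
  have Pk k : P k (lambda', nu') = power_sum k rho nu'.
    by have [_ _ Pv] := P_ext k; apply: Pv.
  rewrite !Pk; exact: irreducible_power_sum.
split; first by apply: (zero_ext _ (P_line 1%N nu)) => mu /PE -/(_ nu)[].
apply/eqP; rewrite -subr_eq0 -mulN1r; apply/eqP.
apply: (zero_ext (fun lambda => P 2%N (lambda, nu) + (-1) * (((\dim {:g})%:R^-1 *
   (q2_dual (lambda + delta) + - q2_dual delta)) * q2 nu * P 0%N (lambda, nu)))).
  apply: line_polyD; first exact: P_line.
  apply: line_polyM; first exact: line_poly_cst.
  apply: line_polyM; last exact: P_line.
  apply: line_polyM; last exact: line_poly_cst.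
  apply: line_polyM; first exact: line_poly_cst.
  by apply: line_polyD; [exact: q2_dual_line_poly|exact: line_poly_cst].
by move=> mu /PE -/(_ nu)[_ ->]; rewrite mulN1r subrr.
Qed.

Local Open Scope classical_set_scope.

Theorem corollary1 (R : realType) (g : lieAlgType R[i]) (t : {vspace g})
    (Pos : set (dual t)) (P : nat -> dual t * subvs_of t -> R[i])
    (g_simple : simple_lie g)
    (t_cartan : cartan_subalgebra t)
    (Pos_positive : positive_roots Pos)
    (P_ext : forall k : nat, extends_power_sum Pos k (P k)) :
  let delta := half_sum Pos in
  P 1%N = 0 /\
  P 2%N = ((\dim {:g})%:R^-1 *:
             (translate delta (q2_dual \o fst) - cst (q2_dual delta)))
          * (q2 \o snd) * P 0%N.
Proof.
have PE := extended_power_sum g_simple t_cartan Pos_positive P_ext.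
split; apply/funext => -[lambda nu]; have [P1 P2] := PE lambda nu; first exact: P1.
exact: P2.
Qed.
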